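(* Let $\mathrm{RD}(n)$ denote the resolvent degree of the general polynomial of degree $n$. Then: (1) For $n\ge 109$, $\mathrm{RD}(n)\le n-7$. (2) For $n\ge 325$, $\mathrm{RD}(n)\le n-8$. (3) For each integer $9\le\ell\le 14$ and each $n>\frac{(\ell-1)!}{24}$, $\mathrm{RD}(n)\le n-\ell$.
   Context: All fields are finitely generated field extensions of $\mathbb{C}$. For a finite field extension $L/K$, $\mathrm{RD}(L/K)$ is the minimal $d$ for which there is a tower of finite field extensions $K=E_0\subseteq E_1\subseteq\cdots\subseteq E_\ell$ such that $L$ embeds into $E_\ell$ over $K$ and for each $i$ there are a subfield $\mathbb{C}\subseteq F_i\subseteq E_i$ with $\mathrm{tr.deg}_{\mathbb{C}}(F_i)\le d$ and a finite extension $\widetilde F_i/F_i$ with $E_{i+1}\cong E_i\otimes_{F_i}\widetilde F_i$. For $n\ge 1$ let $K_n=\mathbb{C}(a_1,\dots,a_n)$ be purely transcendental with transcendence basis $a_1,\dots,a_n$, let $\phi_n(z)=z^n+a_1z^{n-1}+\cdots+a_{n-1}z+a_n\in K_n[z]$, and let $K_n'=K_n[z]/(\phi_n(z))$. Then $\mathrm{RD}(n):=\mathrm{RD}(K_n'/K_n)$. *)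

(* Defs.v *)
From HB Require Import structures.
From mathcomp Require Import all_boot all_order all_algebra all_fingroup all_field.
From mathcomp Require Import reals.
From mathcomp.real_closed Require Import complex.
From mathcomp Require Import mpoly zify.

Set Implicit Arguments.
Unset Strict Implicit.
Unset Printing Implicit Defensive.

Import GRing.Theory.
Local Open Scope ring_scope.

Section TensorProduct.
Variables (F A B T : comNzRingType) (f : F -> A) (g : F -> B).

Definition balanced (V : zmodType) (beta : A -> B -> V) : Prop :=
  [/\ forall a a' b, beta (a + a') b = beta a b + beta a' b,
      forall a b b', beta a (b + b') = beta a b + beta a b'
    & forall x a b, beta (a * f x) b = beta a (g x * b)].

(* T, with a (x) b |-> u a * v b, satisfies the universal property of the
   tensor product of A and B over F, where F acts on A via f and on B via g.
   When f, g, u and v are ring morphisms this says that A (x)_F B -> T is an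
   isomorphism of rings; balancedness at a = b = 1 gives u \o f =1 v \o g. *)
Definition is_tensor_product (u : A -> T) (v : B -> T) : Prop :=
  balanced (fun a b => u a * v b) /\
  forall (V : zmodType) (beta : A -> B -> V), balanced beta ->
    exists h : {additive T -> V},
      (forall a b, h (u a * v b) = beta a b) /\
      (forall h' : {additive T -> V},
         (forall a b, h' (u a * v b) = beta a b) -> h' =1 h).

End TensorProduct.

(* A field containing C is a field F together with a morphism c : C -> F. *)
Section TranscendenceDegree.
Variables (C F : fieldType) (c : {rmorphism C -> F}).

Definition alg_indep m (b : 'I_m -> F) : Prop :=
  forall p : {mpoly C[m]}, mmap c b p = 0 -> p = 0.

(* y \in C(b_0, ..., b_(m-1)) *)
Definition in_adjoin m (b : 'I_m -> F) (y : F) : Prop :=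
  exists p q : {mpoly C[m]}, mmap c b q != 0 /\ y = mmap c b p / mmap c b q.

Definition algebraic_over m (b : 'I_m -> F) (x : F) : Prop :=
  exists P : {poly F}, [/\ P != 0, forall k, in_adjoin b P`_k & root P x].

Definition transcendence_basis m (b : 'I_m -> F) : Prop :=
  alg_indep b /\ forall x, algebraic_over b x.

Definition trdeg_le (d : nat) : Prop :=
  exists m (b : 'I_m -> F), (m <= d)%N /\ transcendence_basis b.

End TranscendenceDegree.

Section ResolventDegree.
Variables (C K : fieldType) (iota : {rmorphism C -> K}).

(* E' = E (x)_F Ft for a finite extension Ft of a field F with
   C <= F <= E and tr.deg_C F <= d; the isomorphism is one of E-algebras, the
   structure map of E' being the inclusion E <= E' (vsproj is the identity on
   elements of E').  The maps j and v embed F and Ft into E and E'. *)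
Definition RD_step (d : nat) (M : fieldExtType K) (E E' : {subfield M}) : Prop :=
  exists (F : fieldType) (c : {rmorphism C -> F})
         (j : {rmorphism F -> subvs_of E})
         (Ft : fieldExtType F) (v : {rmorphism Ft -> subvs_of E'}),
    [/\ forall z, j (c z) = (iota z)%:A,
        trdeg_le c d
      & is_tensor_product j (in_alg Ft)
          (fun x : subvs_of E => vsproj E' (vsval x)) v].

(* There is a tower K = E 0 <= ... <= E l as in the definition of RD(L/K), with
   parameter d; the tower is realised inside its top field M = E l. *)
Definition RD_le (L : fieldExtType K) (d : nat) : Prop :=
  exists (M : fieldExtType K) (l : nat) (E : nat -> {subfield M}),
    [/\ E 0%N = 1%AS,
        E l = fullv%AS,
        forall i, (i < l)%N -> (E i <= E i.+1)%VS /\ RD_step d (E i) (E i.+1)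
      & exists f : {lrmorphism L -> M}, injective f].

(* RD(L/K) = r *)
Definition is_RD (L : fieldExtType K) (r : nat) : Prop :=
  RD_le L r /\ forall d, RD_le L d -> (r <= d)%N.

End ResolventDegree.

Lemma fraction_numden (A : idomainType) (x : {fraction A}) :
  exists u v : A, v != 0 /\ FracField.tofrac v * x = FracField.tofrac u.
Proof.
elim/quotW: x => -[[u v] /= v0]; exists u, v; split=> //.
unlock FracField.tofrac; rewrite -[LHS]FracField.pi_mul.
apply/eqmodP; rewrite /= FracField.equivfE /FracField.mulf /=.
by rewrite !numden_Ratio ?oner_neq0 ?mul1r ?mulr1.
Qed.

Lemma clear_denominators (A : idomainType) (g : {poly {fraction A}}) :
  exists (d : A) (G : {poly A}),
    d != 0 /\ map_poly (@FracField.tofrac A) G = FracField.tofrac d *: g.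
Proof.
elim/poly_ind: g => [|g x [d [G [d0 eG]]]].
  by exists 1, 0; rewrite oner_neq0 scaler0 map_poly0.
have [u [v [v0 ex]]] := fraction_numden x.
exists (v * d), ((v *: G) * 'X + (u * d)%:P); split; first exact: mulf_neq0.
rewrite rmorphD rmorphM /= map_polyX map_polyC map_polyZ eG.
rewrite /= !tofracM -ex scalerDr scalerA -scalerAl; congr (_ + _).
by rewrite -mul_polyC -polyCM mulrAC.
Qed.

Section GeneralPolynomial.
Variables (C : fieldType) (n : nat).

(* C(a_1, ..., a_n); the coordinate 'X_i stands for a_(i+1). *)
Definition ratfun := {fraction {mpoly C[n]}}.

Definition ratfunC : {rmorphism C -> ratfun} :=
  (@FracField.tofrac {mpoly C[n]} \o @mpolyC n C).

Definition general_poly : {poly ratfun} :=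
  'X^n + \sum_(i < n) (@FracField.tofrac {mpoly C[n]} 'X_i) *: 'X^(n - i.+1).

(* Irreducibility of general_poly: after clearing denominators, a factorisation
   is sent by a_(i+1) |-> mesym (i+1) to one of \prod_i ('X + 'X_i) with
   symmetric coefficients, so a factor vanishing at one - 'X_i vanishes at all. *)
Let frac := @FracField.tofrac {mpoly C[n]}.

Let vpoly : {poly {mpoly C[n]}} :=
  'X^n + \sum_(i < n) 'X_i *: 'X^(n - i.+1).

Let map_vpoly : map_poly frac vpoly = general_poly.
Proof.
rewrite /vpoly rmorphD /= map_polyXn rmorph_sum; congr (_ + _).
by apply: eq_bigr => i _; rewrite /= map_polyZ map_polyXn.
Qed.

Let size_tail :
  (size (\sum_(i < n) frac 'X_i *: 'X^(n - i.+1))%R <= n)%N.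
Proof.
apply: leq_trans (size_sum _ _ _) _; apply/bigmax_leqP => i _.
apply: leq_trans (size_scale_leq _ _) _; rewrite size_polyXn.
by rewrite subnSK ?ltn_ord ?leq_subr.
Qed.

Lemma size_general_poly : size general_poly = n.+1.
Proof. by rewrite size_polyDl size_polyXn // ltnS. Qed.

Lemma monic_general_poly : general_poly \is monic.
Proof. by apply/monicP; rewrite lead_coefDl ?lead_coefXn // size_polyXn. Qed.

Let S : n.-tuple {mpoly C[n]} := [tuple mesym n C i.+1 | i < n].
Let sigma := comp_mpoly S.

Let map_sigma : map_poly sigma vpoly = \prod_(i < n) ('X + ('X_i)%:P).
Proof.
pose f : {mpoly int[n]} -> {mpoly C[n]} := mmap intr (fun i => - 'X_i).
have := congr1 (map_poly f) (Viete n).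
rewrite rmorph_prod /= (eq_bigr (fun i => 'X + ('X_i)%:P)); last first.
  by move=> i _; rewrite raddfB /= map_polyX map_polyC /= /f mmapX mmap1U polyCN opprK.
move=> ->; rewrite big_ord_recl /= expr0 scale1r mesym0E scale1r subn0.
rewrite /vpoly !rmorphD /= !map_polyXn !rmorph_sum; congr (_ + _).
apply: eq_bigr => i _; rewrite /= !map_polyZ !map_polyXn scalerA; congr (_ *: _).
rewrite [LHS]mmapX mmap1U tnth_mktuple /bump /= add1n.
rewrite rmorphXn rmorphN1 /f [mesym n int _]/mesym !raddf_sum /= mulr_sumr.
apply: eq_bigr => h /eqP hc; rewrite rmorph_prod /=.
rewrite [in RHS](eq_bigr (fun j => - 'X_j : {mpoly C[n]})); last first.
  by move=> j _; rewrite mmapX mmap1U.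
by rewrite prodrN hc mulrA -exprMn mulrNN mulr1 expr1n mul1r.
Qed.

Let sigma_inj : injective sigma.
Proof. by move=> p q; apply: msym_fundamental_un. Qed.

Let msym_sigma s p : msym s (sigma p) = sigma p.
Proof.
apply/issymP; rewrite /sigma; apply: mcomp_sym => i.
by rewrite -tnth_nth tnth_mktuple mesym_sym.
Qed.

Let size_root (G : {poly {mpoly C[n]}}) (i : 'I_n) : G != 0 ->
  root (map_poly sigma G) (- 'X_i) -> (n < size G)%N.
Proof.
move=> G0 ri.
have rj (j : 'I_n) : root (map_poly sigma G) (- 'X_j).
  have := rmorph_root (msym (tperm i j)) ri.
  rewrite rmorphN /= /msym mmapX mmap1U tpermL -map_poly_comp.
  by rewrite (@eq_map_poly _ _ _ sigma) // => p; apply: msym_sigma.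
have X_inj : injective (fun j : 'I_n => - 'X_j : {mpoly C[n]}).
  move=> j k /oppr_inj /(congr1 (fun p => p@_U_(j)%MM)).
  rewrite !mcoeffX eqxx; case: eqP => [e _|_ /eqP]; last by rewrite oner_eq0.
  move: (congr1 (fun m : 'X_{1..n} => m j) e); rewrite !mnm1E eqxx.
  by case: eqP => // ->.
rewrite -(size_map_inj_poly sigma_inj (rmorph0 sigma)).
rewrite -[X in (X < _)%N]size_enum_ord -(size_map (fun j => - 'X_j : {mpoly C[n]})).
apply: max_poly_roots.
- by rewrite map_poly_eq0_id0 // -(rmorph0 sigma) (inj_eq sigma_inj) lead_coef_eq0.
- by apply/allP => _ /mapP [j _ ->].
- by rewrite map_inj_uniq ?enum_uniq.
Qed.

Lemma general_poly_irreducible : (0 < n)%N ->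
  monic_irreducible_poly general_poly.
Proof.
move=> n_gt0; split; last exact: monic_general_poly.
have phi0 : general_poly != 0 by rewrite -size_poly_eq0 size_general_poly.
split=> [|q sq]; first by rewrite size_general_poly.
rewrite dvdp_eq; set u := _ %/ _; rewrite -/u => /eqP e.
have /andP [u0 q0] : (u != 0) && (q != 0) by rewrite -negb_or -mulf_eq0 -e.
have s_e : (size u + size q = n.+2)%N.
  have := size_mul u0 q0; rewrite -e size_general_poly => ->.
  by rewrite prednK // addn_gt0 size_poly_gt0 u0.
have [d [Q [d0 eQ]]] := clear_denominators q.
have [c [U [c0 eU]]] := clear_denominators u.
have frac0 x : x != 0 -> frac x != 0 by rewrite tofrac_eq0.
have frac_inj : injective frac by move=> x y /eqP; rewrite tofrac_eq => /eqP.
have sQ : size Q = size q.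
  by rewrite -(size_map_inj_poly frac_inj (rmorph0 _)) eQ size_scale ?frac0.
have sU : size U = size u.
  by rewrite -(size_map_inj_poly frac_inj (rmorph0 _)) eU size_scale ?frac0.
have Q0 : Q != 0 by rewrite -size_poly_eq0 sQ size_poly_eq0.
have U0 : U != 0 by rewrite -size_poly_eq0 sU size_poly_eq0.
have eV : (c * d) *: vpoly = U * Q.
  apply: (map_inj_poly frac_inj (rmorph0 _)); rewrite rmorphM /= eU eQ.
  by rewrite map_polyZ map_vpoly e -scalerAl -scalerAr scalerA rmorphM.
have := congr1 (map_poly sigma) eV; rewrite map_polyZ map_sigma [RHS]rmorphM /= => eS.
pose i0 := Ordinal n_gt0.
have : root (map_poly sigma U * map_poly sigma Q) (- 'X_i0).
  rewrite -eS /root hornerZ (bigD1 i0) //= hornerM hornerD hornerX hornerC.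
  by rewrite addNr mul0r mulr0.
rewrite rootM => /orP [] /size_root.
- move=> /(_ U0); rewrite sU => lt; exfalso.
  have : (0 < size q)%N by rewrite size_poly_gt0.
  move: s_e sq lt; move: (size u) (size q) => a b; lia.
- move=> /(_ Q0); rewrite sQ => lt.
  have q_phi : q %| general_poly by rewrite e dvdp_mulIr.
  rewrite -dvdp_size_eqp // size_general_poly eqn_leq lt andbT.
  have : (0 < size u)%N by rewrite size_poly_gt0.
  move: s_e; move: (size u) (size q) => a b; lia.
Qed.

(* K_n[z] / (phi_n(z)), as a finite extension of K_n *)
Definition general_ext (n_gt0 : (0 < n)%N) : fieldExtType ratfun :=
  {poly %/ general_poly with general_poly_irreducible n_gt0}.

(* RD(n) = r *)
Definition is_general_RD (r : nat) : Prop :=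
  exists n_gt0 : (0 < n)%N, is_RD ratfunC (general_ext n_gt0) r.

End GeneralPolynomial.

(* Main.v *)
From HB Require Import structures.
Require Import Defs.
From mathcomp Require Import all_boot all_algebra all_fingroup all_field generic_quotient.
From mathcomp Require Import reals.
From mathcomp.real_closed Require Import complex.
From mathcomp Require Import boolp.
From mathcomp Require filter.
From mathcomp Require Import mpoly zify ring.

(** Put d = n - l and K = C(a_1, ..., a_n). Inside an algebraically closed
    field W containing K, let E be the closure of K under adjoining elements
    that are algebraic over C(t_1, ..., t_d) for elements t_i obtained before.
    An element of E needs only finitely many adjunctions, and each of them is a
    step of a tower with parameter d: if x is algebraic over C(t) with t in the
    field E', let F be the field of the elements of E' algebraic over C(t). The
    minimal polynomial of x over E' has its coefficients in F, because its roots
    are algebraic over C(t), so that E'(x) is the tensor product of E' and F(x)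
    over F (RD_step_adjoin). Therefore RD(n) <= d as soon as the general
    polynomial has a root in E.

    Any polynomial over E whose coefficients lie in C(b_1, ..., b_d), for some
    b_i in E, has a root in E. The claim is that over every field of
    characteristic 0 with this property, every polynomial f of degree n has a
    root (degree_solvable). A reducible f has a factor of degree at most d, which
    has at most d coefficients besides 1. For f irreducible, Tschirnhaus
    transformations apply. The characteristic polynomial of a combination
    b_0 + b_1 z + ... of the powers of z modulo f has as coefficients
    forms T_k of degree k in the b_j. If T_1, ..., T_(l-1) vanish at some b <> 0
    over E, this characteristic polynomial has, after a change of scale, only
    n - l parameters, hence a root e in E. As f is irreducible, the element is
    then e itself; its trace -T_1 vanishes, so e = 0 and b = 0, a contradiction:
    no f of degree n is irreducible (irreducible_has_root).

    It remains to find b. In E only polynomials of degree at most some D can be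
    assumed solvable, and over such a field r forms in r + 1 variables have a
    common zero if the product of their degrees is at most D
    (bezout_rational_zero). This is Bezout's theorem in a form that keeps
    track of the equations to be solved, and it is proved by deforming the forms
    f_i to t x_i^(d_i) - f_i and letting t tend to 0. Applied to all the T_k it would
    require (l-1)! <= D. Instead one looks for a linear space of dimension
    l - 4 on which T_1, ..., T_4 vanish, and applies it on this space to T_5, ...,
    T_(l-1) only, which requires (l-1)!/24 <= D. The linear space is built from
    points by polar cones: a form vanishes on the span of a zero q and of a
    linear space where its polars at q vanish (linear_zeros_cone). This takes many
    variables but equations of small degree, and the number of variables gives
    the bounds 109 for l = 7 and 325 for l = 8. For 9 <= l <= 14 the condition
    n > (l-1)!/24 leaves enough variables; polynomials of degree between n - l
    and (l-1)!/24 are solvable by the case l - 1 (degree_solvable_step). *)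

Set Implicit Arguments.
Unset Strict Implicit.
Unset Printing Implicit Defensive.

Import GRing.Theory.
Local Open Scope ring_scope.

(** * Ideals generated by fewer forms than variables *)

Lemma lin_sys_nontrivial (k : fieldType) (A B : finType) (m : A -> B -> k) :
  (#|B| < #|A|)%N ->
  exists x : A -> k, (exists a, x a != 0) /\ forall b, \sum_a x a * m a b = 0.
Proof.
move=> ltBA; pose M := \matrix_(i < #|A|, j < #|B|) m (enum_val i) (enum_val j).
have : kermx M != 0.
  by rewrite kermx_eq0 /row_free; apply: contraTneq ltBA => <-; rewrite -leqNgt rank_leq_col.
case/rowV0Pn => v /sub_kermxP vM /matrix0Pn [i0 [j0 vj0]].
exists (fun a => v 0 (enum_rank a)); split.
  by exists (enum_val j0); rewrite enum_valK -(ord1 i0).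
move=> b; have /matrixP /(_ 0 (enum_rank b)) := vM; rewrite !mxE => e; rewrite -[RHS]e.
rewrite (reindex (@enum_val _ (mem A))) /=; last exact/onW_bij/enum_val_bij.
by apply: eq_bigr => j _; rewrite enum_valK !mxE enum_rankK.
Qed.

Lemma exists_submonomial (n m : nat) (g : 'X_{1..n}) : (m <= mdeg g)%N ->
  exists2 h : 'X_{1..n}, (h <= g)%MM & mdeg h = m.
Proof.
move=> /subnKC; move: (_ - _)%N => e; elim: e g => [|e IHe] g.
  by rewrite addn0 => ->; exists g; first exact: lepm_refl.
rewrite addnS => ge; have [i gi] : exists i, g i != 0%N.
  apply/existsP; apply: contra_eqT ge; rewrite negb_exists => /forallP H.
  suff -> : g = 0%MM by rewrite mdeg0.
  by apply/mnmP => i; rewrite mnm0E; apply/eqP; move: (H i); rewrite negbK.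
have Ug : (U_(i) <= g)%MM.
  by apply/mnm_lepP => j; rewrite mnm1E; case: eqP => [<-|//]; rewrite lt0n.
have eg : (m + e)%N = mdeg (g - U_(i)).
  by apply/eqP; rewrite -eqSS ge -{1}(submK Ug) mdegD mdeg1 addn1.
have [h le2 eh] := IHe _ eg.
exists h => //; apply: lepm_trans le2 _; apply/mnm_lepP => j.
by rewrite mnmBE leq_subr.
Qed.

Lemma pihomogMr (k : comNzRingType) (n e m : nat) (h G : {mpoly k[n]}) :
  G \is e.-homog -> pihomog mdeg (e + m) (h * G) = pihomog mdeg m h * G.
Proof.
move=> homG; rewrite {1}(pihomog_partitionE (leqnn (msize h))).
rewrite mulr_suml raddf_sum /=.
have hp i : pihomog mdeg i h * G \is (i + e).-homog by apply: dhomogM => //; exact: pihomogP.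
case: (ltnP m (msize h)) => hm.
  rewrite (bigD1 (Ordinal hm)) //= pihomog_dE ?(addnC e) ?hp // big1 ?addr0 // => i im.
  by apply: pihomog_ne0 (hp i); rewrite eqn_add2r.
rewrite big1 => [|i _]; last first.
  by apply: pihomog_ne0 (hp i); rewrite addnC eqn_add2l neq_ltn (leq_trans (ltn_ord i)).
suff -> : pihomog mdeg m h = 0 by rewrite mul0r.
rewrite pihomogE big_seq_cond big1 // => a /andP [ah /eqP am].
by have := msize_mdeg_lt ah; rewrite am ltnNge hm.
Qed.

Section Krull.
Variables (k : fieldType) (r : nat) (d : 'I_r -> nat).
Variable (F : 'I_r -> {mpoly k[r.+1]}).
Hypothesis d_gt0 : forall i, (0 < d i)%N.
Hypothesis F_homog : forall i, F i \is (d i).-homog.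

Definition ideal (g : {mpoly k[r.+1]}) : Prop :=
  exists h : 'I_r -> {mpoly k[r.+1]}, g = \sum_i h i * F i.

Lemma ideal_pihomog_le m g : ideal g ->
  exists h : 'I_r -> {mpoly k[r.+1]}, pihomog mdeg m g =
    \sum_i (if (d i <= m)%N then pihomog mdeg (m - d i) (h i) * F i else 0).
Proof.
case=> h ->; exists h; rewrite raddf_sum /=; apply: eq_bigr => i _; case: leqP => di.
  by rewrite -(pihomogMr _ _ (F_homog i)) subnKC.
rewrite (pihomog_partitionE (leqnn (msize (h i)))) mulr_suml raddf_sum /=.
rewrite big1 // => j _; apply: (@pihomog_ne0 _ _ mdeg (j + d i)%N).
  by rewrite neq_ltn (leq_trans di) ?orbT ?leq_addl.
by apply: dhomogM => //; exact: pihomogP.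
Qed.

Lemma ideal_pihomog m g : ideal g -> ideal (pihomog mdeg m g).
Proof.
move=> /(ideal_pihomog_le m) [h ->].
exists (fun i => if (d i <= m)%N then pihomog mdeg (m - d i) (h i) else 0).
by apply: eq_bigr => i _; case: ifP => //; rewrite mul0r.
Qed.

Inductive lin_span (X : {mpoly k[r.+1]} -> Prop) : {mpoly k[r.+1]} -> Prop :=
| Span0 : lin_span X 0
| SpanS c x y : X x -> lin_span X y -> lin_span X (c *: x + y).

Lemma lin_span_in X x : X x -> lin_span X x.
Proof. by move=> Xx; rewrite -[x]addr0 -[x]scale1r; apply: SpanS => //; apply: Span0. Qed.

Lemma lin_spanD X x y : lin_span X x -> lin_span X y -> lin_span X (x + y).
Proof. by move=> Hx Hy; elim: Hx => [|c u v Xu _ IH]; rewrite ?add0r // -addrA; apply: SpanS. Qed.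

Lemma lin_spanZ X c x : lin_span X x -> lin_span X (c *: x).
Proof.
elim=> [|e u v Xu _ IH]; first by rewrite scaler0; apply: Span0.
by rewrite scalerDr scalerA; apply: SpanS.
Qed.

Lemma lin_span_sum X (I : Type) (s : seq I) (P : pred I) (G : I -> _) :
  (forall i, P i -> lin_span X (G i)) -> lin_span X (\sum_(i <- s | P i) G i).
Proof. by move=> H; elim/big_ind: _ => // [|x y]; [apply: Span0 | apply: lin_spanD]. Qed.

Definition gen_prod (a : 'I_r -> nat) (b : 'X_{1..r.+1}) : {mpoly k[r.+1]} :=
  \prod_i F i ^+ a i * 'X_[b].

(** A factor of degree m of a monomial of larger degree is expanded over the
    F i; all cofactors have smaller degree since d i > 0, so iterating leaves only
    cofactors of degree below m, times products of the F i. *)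
Lemma monomial_ideal_span m :
  (forall a : 'X_{1..r.+1}, mdeg a = m -> ideal 'X_[a]) ->
  forall g : 'X_{1..r.+1},
  lin_span (fun p => exists a b, [/\ forall i, (a i <= mdeg g)%N, (mdeg b < m)%N
                                & p = gen_prod a b]) 'X_[g].
Proof.
move=> all_m g; have [s] := ubnP (mdeg g); elim: s g => // s IH g les.
case: (ltnP (mdeg g) m) => gm.
  apply: lin_span_in; exists (fun=> 0%N), g; split=> //.
  by rewrite /gen_prod big1 ?mul1r // => i _; rewrite expr0.
have [g2 g2g g2m] := exists_submonomial gm.
have [h eh'] := ideal_pihomog_le m (all_m _ g2m).
rewrite pihomog_dE in eh'; last by rewrite dhomogX; apply/eqP.
rewrite -(submK g2g) mpolyXD eh' mulr_sumr; apply: lin_span_sum => i _.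
case: leqP => di; last by rewrite mulr0; apply: Span0.
rewrite mulrA; set u := _ * pihomog _ _ _.
have hu : u \is ((mdeg g - d i)%N).-homog.
  have -> : (mdeg g - d i = mdeg (g - g2) + (m - d i))%N.
    by rewrite -{1}(submK g2g) mdegD g2m addnBA.
  by apply: dhomogM; [rewrite dhomogX | exact: pihomogP].
have spF y : lin_span (fun p => exists a b, [/\ forall i, (a i <= (mdeg g).-1)%N, (mdeg b < m)%N
                                & p = gen_prod a b]) y ->
  lin_span (fun p => exists a b, [/\ forall i, (a i <= mdeg g)%N, (mdeg b < m)%N
                                & p = gen_prod a b]) (y * F i).
  have g0 : (0 < mdeg g)%N by apply: leq_trans (leq_trans (d_gt0 i) di) gm.
  elim=> [|c x z [a [b [al bm ->]]] _ IHy]; first by rewrite mul0r; apply: Span0.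
  rewrite mulrDl -scalerAl; apply: SpanS IHy.
  exists (fun j => a j + (j == i))%N, b; split=> //.
    by move=> j; have := al j; case: (j == i); lia.
  rewrite /gen_prod mulrAC; congr (_ * _).
  rewrite (bigD1 i) //= [RHS](bigD1 i) //= eqxx addn1 exprS mulrC mulrA; congr (_ * _).
  by apply: eq_bigr => j /negbTE ->; rewrite addn0.
rewrite submK //; apply: spF; rewrite [u]mpolyE big_seq; apply: lin_span_sum => b bu.
apply: lin_spanZ.
have hb : mdeg b = (mdeg g - d i)%N by move/dhomogP: hu; apply.
have ltb : (mdeg b < s)%N by have := d_gt0 i; lia.
have := IH b ltb; elim=> [|c x y [a [e [al em ->]]] _ IHy]; first exact: Span0.
apply: SpanS IHy; exists a, e; split=> // j; apply: leq_trans (al j) _.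
by rewrite hb; have := d_gt0 i; lia.
Qed.

(** Otherwise, by the preceding expansion, the (K+1)^(r+1) monomials with all
    exponents at most K lie in the span of C (M+1)^r elements, where M = (r+1)K
    bounds their degrees and C counts the cofactors of degree below m. For
    K = C (r+1)^r this contradicts their linear independence. *)
Lemma krull_height m :
  ~ (forall a : 'X_{1..r.+1}, mdeg a = m -> ideal 'X_[a]).
Proof.
move/monomial_ideal_span => sp.
pose C := #|{: 'X_{1..r.+1 < m}}|.
pose K := (C * (r.+1 ^ r))%N.
pose M := (r.+1 * K)%N.
pose G : predArgType := {ffun 'I_r.+1 -> 'I_K.+1}.
pose A : predArgType := ({ffun 'I_r -> 'I_M.+1} * 'X_{1..r.+1 < m})%type.
pose mon (g : G) := [multinom (g i : nat) | i < r.+1].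
pose Phi (a : A) := gen_prod (fun i => a.1 i) a.2.
have mon_deg g : (mdeg (mon g) <= M)%N.
  have : (\sum_i mon g i <= \sum_(i < r.+1) K)%N.
    by apply: leq_sum => i _; rewrite mnmE -ltnS ltn_ord.
  by rewrite sum_nat_const card_ord mdegE.
have [w hw] : exists w : G -> A -> k, forall g, 'X_[mon g] = \sum_a w g a *: Phi a.
  suff /fin_all_exists : forall g : G, exists w : A -> k, 'X_[mon g] = \sum_a w a *: Phi a by [].
  move=> g; elim: (sp (mon g)) => [|c x y [a [b [al bm ->]]] _ [w ->]].
    by exists (fun=> 0); rewrite big1 // => a _; rewrite scale0r.
  have am i : (a i < M.+1)%N by rewrite ltnS (leq_trans (al i)).
  pose a0 : A := ([ffun i => Ordinal (am i)], BMultinom bm).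
  exists (fun e => (if e == a0 then c else 0) + w e).
  rewrite (eq_bigr _ (fun e _ => scalerDl _ _ _)) big_split /=; congr (_ + _).
  rewrite (bigD1 a0) //= eqxx big1 ?addr0 => [|e /negbTE ->]; last by rewrite scale0r.
  congr (_ *: _); rewrite /Phi /gen_prod; congr (_ * _).
  by apply: eq_bigr => i _; rewrite ffunE.
have mon_inj : injective mon.
  move=> g h /mnmP e; apply/ffunP => i; apply/val_inj.
  by have := e i; rewrite !mnmE.
have ltAG : (#|A| < #|G|)%N.
  rewrite card_prod !card_ffun !card_ord -/C.
  have MK : (M.+1 <= r.+1 * K.+1)%N by rewrite /M mulnS; lia.
  have powM : (M.+1 ^ r <= (r.+1 * K.+1) ^ r)%N by case: (r) MK => // r' MK; rewrite leq_exp2r.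
  apply: leq_ltn_trans (leq_mul powM (leqnn C)) _.
  by rewrite expnMn expnS mulnAC (mulnC _ C) -/K ltn_pmul2r ?expn_gt0.
have [x [[g0 xg0] hx]] := lin_sys_nontrivial w ltAG.
have : \sum_g x g *: 'X_[mon g] = 0 :> {mpoly k[r.+1]}.
  under eq_bigr do rewrite hw scaler_sumr.
  rewrite exchange_big big1 //= => a _.
  under eq_bigr do rewrite scalerA.
  by rewrite -scaler_suml hx scale0r.
move/(congr1 (mcoeff (mon g0))); rewrite raddf_sum mcoeff0 (bigD1 g0) //= big1.
  by rewrite addr0 mcoeffZ mcoeffX eqxx mulr1; apply/eqP.
by move=> g /negbTE ng; rewrite mcoeffZ mcoeffX (inj_eq mon_inj) ng mulr0.
Qed.
End Krull.

(** * Rational zeros of homogeneous ideals *)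

Section Ideals.
Variables (n : nat) (E : comNzRingType).
Implicit Types (I J : {mpoly E[n]} -> Prop).

Definition is_ideal I : Prop :=
  [/\ I 0, forall u v, I u -> I v -> I (u + v) & forall g u, I u -> I (g * u)].

Definition adjoin_ideal I (l : {mpoly E[n]}) : {mpoly E[n]} -> Prop :=
  fun g => exists u v, I u /\ g = u + v * l.

Lemma is_ideal_adjoin I l : is_ideal I -> is_ideal (adjoin_ideal I l).
Proof.
case=> I0 ID IM; split.
- by exists 0, 0; rewrite mul0r addr0.
- move=> _ _ [u [v [Iu ->]]] [u' [v' [Iu' ->]]].
  by exists (u + u'), (v + v'); split; [exact: ID | ring].
- move=> g _ [u [v [Iu ->]]]; exists (g * u), (g * v); split; first exact: IM.
  by rewrite mulrDr mulrA.
Qed.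

Lemma adjoin_ideal_sub I l g : I g -> adjoin_ideal I l g.
Proof. by move=> Ig; exists g, 0; rewrite mul0r addr0. Qed.

Lemma adjoin_ideal_gen I l : is_ideal I -> adjoin_ideal I l l.
Proof. by case=> I0 _ _; exists 0, 1; rewrite add0r mul1r. Qed.

Lemma is_idealZ I c g : is_ideal I -> I g -> I (c *: g).
Proof. by case=> _ _ IM Ig; rewrite -mul_mpolyC; apply: IM. Qed.

Lemma is_idealN I g : is_ideal I -> I g -> I (- g).
Proof. by move=> II Ig; rewrite -scaleN1r; apply: is_idealZ. Qed.

Lemma is_ideal_sum I (T : Type) (s : seq T) (P : pred T) (G : T -> {mpoly E[n]}) :
  is_ideal I -> (forall i, P i -> I (G i)) -> I (\sum_(i <- s | P i) G i).
Proof. by case=> I0 ID _ H; elim/big_ind: _. Qed.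

Lemma is_ideal_congrM I a b c e : is_ideal I ->
  I (a - b) -> I (c - e) -> I (a * c - b * e).
Proof.
case=> _ ID IM Iab Ice.
have -> : a * c - b * e = c * (a - b) + b * (c - e) by ring.
by apply: ID; apply: IM.
Qed.

End Ideals.

Section BinaryForm.
Variables (E : fieldType) (A : comAlgType E) (y z : A).

Implicit Types P Q : {poly E}.

(** The homogenization of Q to degree N, evaluated at (y, z). *)
Definition binary_form (Q : {poly E}) (N : nat) : A :=
  \sum_(l < N.+1) Q`_l *: (y ^+ l * z ^+ (N - l)).

Lemma binary_form_mulX Q N : binary_form (Q * 'X) N.+1 = y * binary_form Q N.
Proof.
rewrite /binary_form big_ord_recl coefMX /= scale0r add0r mulr_sumr.
apply: eq_bigr => l _; rewrite coefMX /= subSS -scalerAr; congr (_ *: _).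
by rewrite exprS mulrA.
Qed.

Lemma binary_formZ c Q N : binary_form (c *: Q) N = c *: binary_form Q N.
Proof. by rewrite /binary_form scaler_sumr; apply: eq_bigr => l _; rewrite coefZ scalerA. Qed.

Lemma binary_formD P Q N : binary_form (P + Q) N = binary_form P N + binary_form Q N.
Proof. by rewrite /binary_form -big_split; apply: eq_bigr => l _; rewrite coefD scalerDl. Qed.

Lemma binary_formS Q N : (size Q <= N.+1)%N -> binary_form Q N.+1 = z * binary_form Q N.
Proof.
move=> sQ; rewrite /binary_form big_ord_recr /= nth_default // scale0r addr0 mulr_sumr.
apply: eq_bigr => l _; rewrite -scalerAr; congr (_ *: _).
by rewrite subSn -1?ltnS // exprS; ring.
Qed.

Lemma binary_form_mul_linear Q N c : (size Q <= N.+1)%N ->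
  binary_form (Q * ('X - c%:P)) N.+1 = (y - c *: z) * binary_form Q N.
Proof.
move=> sQ; have -> : Q * ('X - c%:P) = Q * 'X + (- c) *: Q.
  by rewrite mulrBr (mulrC Q c%:P) mul_polyC scaleNr.
rewrite binary_formD binary_form_mulX binary_formZ binary_formS // mulrBl.
by rewrite scaleNr scalerAl.
Qed.

Lemma binary_form_mulXn Q N m : (size Q <= N.+1)%N ->
  binary_form Q (m + N) = z ^+ m * binary_form Q N.
Proof.
move=> sQ; elim: m => [|m IH]; first by rewrite mul1r.
rewrite addSn binary_formS ?IH ?exprS ?mulrA //.
by apply: leq_trans sQ _; rewrite ltnS leq_addl.
Qed.

End BinaryForm.

Section RationalPoint.
Variables (n : nat) (E : fieldType) (D : nat).
Hypothesis rootE : forall p : {poly E}, (1 < size p <= D.+1)%N -> exists x, root p x.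
Implicit Types (I J : {mpoly E[n]} -> Prop).
Variable i : 'I_n.

(** This is how to say, without leaving E, that I has zeros whose i-th
    coordinate does not vanish. *)
Definition nonnilpotent I : Prop := forall m, ~ I ('X_i ^+ m).

(** Let c be a root of Q = (X - c) Q'. If x_i^m = u + v (x_j - c x_i) with u in
    I, then multiplying by the form of Q' turns the second term into the form of
    Q, which is in I: so x_i^m times the form of Q' is in I, and Q' takes the place
    of Q. When Q is constant, I contains a power of x_i. *)
Lemma nonnilpotent_adjoin_root I j (Q : {poly E}) N :
  is_ideal I -> nonnilpotent I -> Q != 0 -> (size Q <= D.+1)%N -> (size Q <= N.+1)%N ->
  I (binary_form 'X_j 'X_i Q N) ->
  exists c : E, nonnilpotent (adjoin_ideal I ('X_j - c *: 'X_i)).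
Proof.
move=> II nI; have [_ _ IM] := II; have [s] := ubnP (size Q); elim: s Q N => // s IH Q N sQs Q0 sQ sQN IQ.
have [sQ1|sQ1] := leqP (size Q) 1.
  case: (nI N); rewrite (size1_polyC sQ1) in IQ Q0 *.
  move: IQ; rewrite polyC_eq0 in Q0 *.
  rewrite /binary_form big_ord_recl coefC eqxx expr0 mul1r subn0 big1 ?addr0; last first.
    by move=> l _; rewrite coefC /= scale0r.
  move=> IQ; rewrite -[_ ^+ _]scale1r -(mulVf Q0) -scalerA; exact: is_idealZ.
have [c rc] : exists c, root Q c by apply: rootE; rewrite sQ1.
have [Q' eQ] := factor_theorem _ _ rc.
have Q'0 : Q' != 0 by apply: contraNneq Q0 => Q'0; rewrite eQ Q'0 mul0r.
have sQ' : size Q = (size Q').+1.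
  by rewrite eQ size_Mmonic ?monicXsubC // size_XsubC addn2.
have N0 : (0 < N)%N by rewrite -ltnS (leq_trans sQ1).
have := IQ; rewrite eQ -(prednK N0) binary_form_mul_linear; last by rewrite prednK // -ltnS -sQ'.
move=> IQ'.
case: (pselect (nonnilpotent (adjoin_ideal I ('X_j - c *: 'X_i)))) => [|nn]; first by exists c.
have [m [u [v [Iu em]]]] : exists m, adjoin_ideal I ('X_j - c *: 'X_i) ('X_i ^+ m).
  by apply: contrapT => nex; apply: nn => m Im; apply: nex; exists m.
have sQ'N : (size Q' <= N.-1.+1)%N by rewrite prednK // -ltnS -sQ'.
apply: (IH Q' (m + N.-1)%N) => //.
- by rewrite -ltnS -sQ'.
- by apply: leq_trans sQ; rewrite sQ'.
- by apply: leq_trans sQ'N _; rewrite ltnS leq_addl.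
rewrite binary_form_mulXn // em mulrDl.
case: II => _ ID _; apply: ID; first by rewrite mulrC; exact: IM.
by rewrite -mulrA; apply: IM.
Qed.

(** One adjoins linear forms x_j - c_j x_i for all j, keeping x_i non-nilpotent.
    Modulo the resulting ideal a form f of degree m is f(c) x_i^m, so f(c) = 0 if f
    is in I. *)
Lemma ideal_rational_zero I : is_ideal I -> nonnilpotent I ->
  (forall j, exists Q : {poly E},
     [/\ Q != 0, (size Q <= D.+1)%N & I (binary_form 'X_j 'X_i Q D)]) ->
  exists c : 'I_n -> E, c i = 1 /\
    forall m f, f \is m.-homog -> I f -> f.@[c] = 0.
Proof.
move=> II nI hQ.
have [c [J [IJ IsubJ nJ hJ]]] : exists (c : 'I_n -> E) J,
  [/\ is_ideal J, forall g, I g -> J g, nonnilpotent J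
    & forall j, j \in enum 'I_n -> J ('X_j - c j *: 'X_i)].
  elim: (enum 'I_n) => [|j s [c [J [IJ IsubJ nJ hJ]]]].
    by exists (fun=> 0), I; split.
  have [Q [Q0 sQ IQ]] := hQ j.
  have [e ne] := nonnilpotent_adjoin_root IJ nJ Q0 sQ sQ (IsubJ _ IQ).
  exists (fun l => if l == j then e else c l), (adjoin_ideal J ('X_j - e *: 'X_i)).
  split=> //; first exact: is_ideal_adjoin.
    by move=> g /IsubJ; apply: adjoin_ideal_sub.
  move=> l; rewrite inE; case: eqP => [-> _|_ /= /hJ]; last exact: adjoin_ideal_sub.
  exact: adjoin_ideal_gen.
have {}hJ j : J ('X_j - c j *: 'X_i) by apply: hJ; rewrite mem_enum.
have ci : c i = 1.
  apply/eqP; rewrite eq_sym -subr_eq0; apply: contraT => c1; case: (nJ 1%N).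
  rewrite expr1 -['X_i]scale1r -(mulVf c1) -scalerA; apply: is_idealZ => //.
  by rewrite scalerBl scale1r.
exists c; split=> // m f hf /IsubJ Jf.
have Jmon (a : 'X_{1..n}) : J ('X_[a] - (\prod_j c j ^+ a j) *: 'X_i ^+ mdeg a).
  rewrite mpolyXE_id mdegE -prodrXr -mul_mpolyC rmorph_prod -big_split /=.
  case: (IJ) => J0 _ _.
  elim/big_ind2: _ => [|x1 x2 y1 y2 Hx Hy|j _]; first by rewrite subrr.
    exact: is_ideal_congrM.
  rewrite mul_mpolyC -exprZn; elim: (a j) => [|l IHl]; first by rewrite !expr0 subrr.
  by rewrite !exprS; apply: is_ideal_congrM.
have : J (f - f.@[c] *: 'X_i ^+ m).
  rewrite {1}[f]mpolyE mevalE scaler_suml -sumrB big_seq.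
  apply: is_ideal_sum => // a af.
  have -> : m = mdeg a by apply/esym; move/dhomogP: hf; apply.
  by rewrite -scalerA -scalerBr; apply: is_idealZ.
move=> Jd; apply/eqP; apply: contraT => fc; case: (nJ m).
have [_ JD _] := IJ.
rewrite -['X_i ^+ m]scale1r -(mulVf fc) -scalerA; apply: is_idealZ => //.
have -> : f.@[c] *: 'X_i ^+ m = f + - (f - f.@[c] *: 'X_i ^+ m) by rewrite opprB addrC subrK.
by apply: JD => //; apply: is_idealN.
Qed.

End RationalPoint.

(** * Bezout's theorem over fields with few solvable equations *)

Section ClearFractions.
Variables (E : fieldType).
Local Notation k := {fraction {poly E}}.
Local Notation tf := (@FracField.tofrac {poly E}).

Lemma common_denominator (I : finType) (x : I -> k) :
  exists (v : {poly E}) (u : I -> {poly E}), v != 0 /\ forall i, tf (u i) = tf v * x i.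
Proof.
have /fin_all_exists [w hw] : forall i, exists w : {poly E} * {poly E},
    w.2 != 0 /\ tf w.2 * x i = tf w.1.
  by move=> i; have [u [v [v0 e]]] := fraction_numden (x i); exists (u, v).
exists (\prod_i (w i).2), (fun i => (\prod_(j | j != i) (w j).2) * (w i).1); split.
  by apply/prodf_neq0 => i _; case: (hw i).
move=> i; have [_ e] := hw i.
by rewrite [in RHS](bigD1 i) //= !tofracM -e mulrCA mulrA.
Qed.

(** After clearing denominators, one divides by the largest common power of the
    indeterminate. *)
Lemma normalize_at0 (I : finType) (x : I -> k) : (exists i, x i != 0) ->
  exists (c : k) (u : I -> {poly E}),
    (exists i, (u i).[0] != 0) /\ forall i, tf (u i) = c * x i.
Proof.
case=> i0 xi0; have [v [u [v0 hu]]] := common_denominator x.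
have ui0 : u i0 != 0.
  by rewrite -tofrac_eq0 hu; apply: mulf_neq0; rewrite ?tofrac_eq0.
move: (tf v) hu => c {v0 v}; have [s] := ubnP (size (u i0)).
elim: s u c ui0 => // s IH u c ui0 su hu.
case: (boolP [exists i, (u i).[0] != 0]) => [/existsP h|]; first by exists c, u.
rewrite negb_exists => /forallP h.
have /fin_all_exists [w hw] : forall i, exists w, u i = w * 'X.
  move=> i; have /factor_theorem [w e] : root (u i) 0 by move: (h i); rewrite negbK.
  by exists w; rewrite e subr0.
have X0 : tf 'X != 0 by rewrite tofrac_eq0 polyX_eq0.
apply: (IH w (c / tf 'X)).
- by apply: contraNneq ui0 => w0; rewrite hw w0 mul0r.
- rewrite hw size_mulX in su => //; apply: contraNneq ui0 => w0; by rewrite hw w0 mul0r.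
move=> i; apply: (mulIf X0); rewrite -tofracM -hw hu.
by rewrite mulrAC divfK.
Qed.

End ClearFractions.

Lemma mcoeff_pihomog (n m : nat) (R : nzRingType) (g : {mpoly R[n]}) a :
  (pihomog mdeg m g)@_a = if mdeg a == m then g@_a else 0.
Proof.
case: ifPn => am; last by apply: (dhomog_nemf_coeff (pihomogP mdeg m g)).
have lt : (m < maxn (msize g) m.+1)%N by rewrite leq_maxr.
rewrite [in RHS](@pihomog_partitionE _ _ mdeg (maxn (msize g) m.+1) g) ?leq_maxl //.
rewrite [RHS](raddf_sum (mcoeff a)) [RHS](bigD1 (Ordinal lt)) //= big1 ?addr0 // => i im.
apply: (dhomog_nemf_coeff (pihomogP mdeg i g)).
by apply: contraNneq im => e; apply/eqP/val_inj; rewrite /= -e; apply/eqP.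
Qed.

Section IdealOps.
Variables (k : fieldType) (r : nat) (F : 'I_r -> {mpoly k[r.+1]}).

Lemma is_ideal_ideal : is_ideal (ideal F).
Proof.
split.
- by exists (fun=> 0); rewrite big1 // => i _; rewrite mul0r.
- move=> _ _ [h ->] [h' ->]; exists (fun i => h i + h' i).
  by rewrite -big_split; apply: eq_bigr => i _; rewrite mulrDl.
- move=> g _ [h ->]; exists (fun i => g * h i).
  by rewrite mulr_sumr; apply: eq_bigr => i _; rewrite mulrA.
Qed.

Lemma ideal_gen i : ideal F (F i).
Proof.
exists (fun j => (j == i)%:R); rewrite (bigD1 i) //= eqxx mul1r big1 ?addr0 //.
by move=> j /negbTE ->; rewrite mul0r.
Qed.

End IdealOps.

(* In the next two sections k stands for E(t), known only through the embedding
   of E[t] and, where relations are specialized, the normalization at t = 0. *)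
Section Bezout.
Variables (E : fieldType) (r : nat) (d : 'I_r -> nat).
Variable (f : 'I_r -> {mpoly E[r.+1]}).
Hypothesis d_gt0 : forall i, (0 < d i)%N.
Hypothesis f_homog : forall i, f i \is (d i).-homog.

Local Notation n := r.+1.

Variables (k : fieldType) (tf : {rmorphism {poly E} -> k}).
Hypothesis tf_inj : injective tf.

(** Over E(t) these forms have only isolated zeros, because their leading terms
    for large t are powers of distinct variables; at t = 0 they become - f i. *)
Definition perturbation (i : 'I_r) : {mpoly {poly E}[n]} :=
  'X *: 'X_(lift ord0 i) ^+ d i - map_mpoly polyC (f i).

Definition generic_form (i : 'I_r) : {mpoly k[n]} := map_mpoly tf (perturbation i).

(** The fibre at t = 0 of the family of ideals generated by the perturbations. *)
Definition limit_ideal (g : {mpoly E[n]}) : Prop :=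
  exists g' : {mpoly {poly E}[n]},
    ideal generic_form (map_mpoly tf g') /\ map_mpoly (horner_eval 0) g' = g.

Lemma map_mpoly_homog (A B : comNzRingType) (h : {rmorphism A -> B}) m (p : {mpoly A[n]}) :
  p \is m.-homog -> map_mpoly h p \is m.-homog.
Proof.
move=> hp; apply/dhomogP => a; rewrite mcoeff_msupp mcoeff_map_mpoly => ha.
move/dhomogP: hp; apply; rewrite mcoeff_msupp; apply: contraNneq ha => ->.
by apply/eqP; exact: rmorph0.
Qed.

Lemma generic_form_homog i : generic_form i \is (d i).-homog.
Proof.
apply: map_mpoly_homog; apply: rpredB; last exact: map_mpoly_homog.
apply: rpredZ; have := @dhomogMn n {poly E} mdeg 1 'X_(lift ord0 i) (d i).
by rewrite mul1n; apply; rewrite dhomogX; apply/eqP; exact: mdeg1.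
Qed.

Lemma mcoeff_at0 (g : {mpoly {poly E}[n]}) a :
  (map_mpoly (horner_eval 0) g)@_a = (g@_a).[0].
Proof. by rewrite mcoeff_map_mpoly. Qed.

Lemma is_ideal_limit : is_ideal limit_ideal.
Proof.
have [J0 JD JM] := is_ideal_ideal generic_form.
split.
- by exists 0; rewrite !raddf0.
- move=> _ _ [g [Jg <-]] [h [Jh <-]]; exists (g + h); rewrite !rmorphD; split=> //.
  exact: JD.
- move=> g _ [h [Jh <-]]; exists (map_mpoly polyC g * h); rewrite !rmorphM /=; split.
    exact: JM.
  congr (_ * _); apply/mpolyP => a; rewrite mcoeff_at0 mcoeff_map_mpoly /=.
  exact: hornerC.
Qed.

Lemma limit_ideal_gen i : limit_ideal (f i).
Proof.
exists (- perturbation i); split.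
  by rewrite raddfN; apply: is_idealN; [exact: is_ideal_ideal | exact: ideal_gen].
apply/mpolyP => a; rewrite mcoeff_at0 mcoeffN mcoeffB mcoeffZ mcoeff_map_mpoly.
by rewrite hornerN hornerD hornerN hornerM hornerX hornerC mul0r sub0r opprK.
Qed.

(** The matrix of coefficients of lifts to E[t] of all monomials of degree m is
    the identity at t = 0, hence invertible over k. The monomials would then lie
    in the ideal of the r generic forms, against krull_height. *)
Lemma limit_ideal_proper m :
  ~ (forall a : 'X_{1..n}, mdeg a = m -> limit_ideal 'X_[a]).
Proof.
move=> H; apply: (@krull_height k r d generic_form d_gt0 generic_form_homog m).
pose B := {a : 'X_{1..n < m.+1} | mdeg a == m}.
have Bm (a : B) : mdeg (val a) = m by apply/eqP; case: a.
have toB (a : 'X_{1..n}) : mdeg a = m -> exists b : B, val (val b) = a.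
  move=> am; have lt : (mdeg a < m.+1)%N by rewrite am.
  have h : mdeg (BMultinom lt : 'X_{1..n < m.+1}) == m by rewrite /= am.
  by exists (exist _ (BMultinom lt) h).
have /fin_all_exists [G hG] : forall a : B, exists g : {mpoly {poly E}[n]},
    ideal generic_form (map_mpoly tf g) /\ map_mpoly (horner_eval 0) g = 'X_[val a].
  by move=> a; exact: H.
pose M := \matrix_(i < #|{: B}|, j < #|{: B}|) (G (enum_val i))@_(val (enum_val j)).
have M0 : map_mx (horner_eval 0) M = 1%:M.
  apply/matrixP => i j; rewrite !mxE.
  have := mcoeff_at0 (G (enum_val i)) (val (enum_val j)); rewrite /horner_eval => <-.
  have [_ ->] := hG (enum_val i); rewrite mcoeffX -(inj_eq enum_val_inj) -val_eqE.
  by rewrite -val_eqE.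
have detM : \det M != 0.
  have := det1 E #|{: B}|; rewrite -M0 det_map_mx; apply: contra_eq_neq => ->.
  by rewrite rmorph0 eq_sym oner_neq0.
pose N := map_mx tf M.
have Nu : N \in unitmx by rewrite unitmxE det_map_mx unitfE -(rmorph0 tf) (inj_eq tf_inj).
move=> a am; have [b eb] := toB a am.
pose u (c : B) : {mpoly k[n]} := pihomog mdeg m (map_mpoly tf (G c)).
have Ju c : ideal generic_form (u c).
  by apply: (ideal_pihomog generic_form_homog); case: (hG c).
have eu i : u (enum_val i) = \sum_j N i j *: 'X_[val (enum_val j)].
  apply/mpolyP => c; rewrite mcoeff_pihomog [RHS](raddf_sum (mcoeff c)) /=; case: eqP => [cm|cm].
    have [e ec] := toB c cm.
    rewrite [RHS](bigD1 (enum_rank e)) //= enum_rankK ec mcoeffZ mcoeffX eqxx mulr1.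
    rewrite !mxE enum_rankK ec big1 ?addr0 ?mcoeff_map_mpoly // => j je.
    rewrite mcoeffZ mcoeffX; case: eqP => [ej|_]; last by rewrite mulr0.
    case/eqP: je; rewrite -(enum_valK j); congr enum_rank; do 2!apply: val_inj.
    exact: etrans ej (esym ec).
  rewrite [RHS]big1 // => j _; rewrite mcoeffZ mcoeffX; case: eqP => [ej|_]; last by rewrite mulr0.
  by case: cm; rewrite -ej; apply: Bm.
have -> : 'X_[a] = \sum_i (invmx N) (enum_rank b) i *: u (enum_val i).
  under eq_bigr do rewrite eu scaler_sumr.
  rewrite exchange_big /= -{1}eb -{1}(enum_rankK b).
  transitivity (\sum_j (1%:M : 'M[k]_#|{: B}|) (enum_rank b) j *: 'X_[val (enum_val j)] : {mpoly k[n]}).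
    rewrite (bigD1 (enum_rank b)) //= mxE eqxx scale1r big1 ?addr0 // => j.
    by rewrite mxE eq_sym => /negbTE ->; rewrite scale0r.
  apply: eq_bigr => j _; rewrite -(mulVmx Nu) mxE scaler_suml.
  by apply: eq_bigr => i _; rewrite scalerA.
apply: is_ideal_sum => [|i _]; first exact: is_ideal_ideal.
by apply: is_idealZ; [exact: is_ideal_ideal|].
Qed.

(** If all x_i^(m_i) are in the ideal, so are all monomials of degree
    \sum_i m_i, as one of their exponents is large enough. *)
Lemma nonnilpotent_variable : exists i, nonnilpotent i limit_ideal.
Proof.
apply: contrapT => nex.
have /fin_all_exists [m hm] : forall i : 'I_n, exists m, limit_ideal ('X_i ^+ m).
  move=> i; apply: contrapT => H; apply: nex; exists i => m Im; apply: H; by exists m.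
apply: (@limit_ideal_proper (\sum_i m i)) => a am.
have [i hi] : exists i, (m i <= a i)%N.
  apply/existsP; apply: contra_eqT am; rewrite negb_exists => /forallP H.
  rewrite mdegE neq_ltn; apply/orP; left.
  have : (\sum_(i < n) (a i).+1 <= \sum_i m i)%N by apply: leq_sum => i _; rewrite ltnNge.
  by apply: leq_trans; rewrite !big_ord_recl addSn ltnS leq_add2l leq_sum.
rewrite (_ : 'X_[a] = 'X_[a - U_(i) *+ m i] * 'X_i ^+ m i :> {mpoly E[n]}); last first.
  rewrite mpolyXn -mpolyXD submK //; apply/mnm_lepP => j; rewrite mulmnE mnm1E.
  by case: eqP => [<-|]; rewrite ?mul1n.
by have [_ _ IM] := is_ideal_limit; apply: IM.
Qed.
End Bezout.

Section BezoutDependence.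
Variables (E : fieldType) (r : nat) (d : 'I_r -> nat).
Variable (f : 'I_r -> {mpoly E[r.+1]}).
Hypothesis d_gt0 : forall i, (0 < d i)%N.
Hypothesis f_homog : forall i, f i \is (d i).-homog.
Local Notation n := r.+1.
Variables (k : fieldType) (tf : {rmorphism {poly E} -> k}).
Hypothesis tf_inj : injective tf.
Hypothesis clear_at0 : forall (I : finType) (x : I -> k), (exists i, x i != 0) ->
  exists (c : k) (u : I -> {poly E}),
    (exists i, (u i).[0] != 0) /\ forall i, tf (u i) = c * x i.

Let D := (\prod_i d i)%N.
Let B : finType := {a : 'X_{1..n < D.+1} | mdeg a == D}.
Let mon (b : B) : 'X_{1..n} := val (val b).
Let nonreduced (b : B) := [exists i : 'I_r, (d i <= mon b (lift ord0 i))%N].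
Let N : finType := {b : B | nonreduced b}.

Let mdeg_mon b : mdeg (mon b) = D.
Proof. by apply/eqP; case: b. Qed.

Let mon_inj : injective mon.
Proof. by move=> a b e; do 2!apply: val_inj. Qed.

(** A monomial of degree D is determined by its exponents at the last r
    variables; for those outside N they lie in a box with \prod_i d i = D
    points. *)
Lemma card_monomials_le : (#|B| <= D + #|N|)%N.
Proof.
have -> : #|N| = #|[pred b : B | nonreduced b]| by rewrite card_sig.
rewrite -[X in (X <= _)%N](cardC [pred b : B | nonreduced b]) addnC leq_add2r.
pose enc (b : B) : {dffun forall i : 'I_r, 'I_(d i)} :=
  [ffun i => insubd (Ordinal (d_gt0 i)) (mon b (lift ord0 i))].
have encE b i : ~~ nonreduced b -> enc b i = mon b (lift ord0 i) :> nat.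
  rewrite negb_exists => /forallP /(_ i); rewrite -ltnNge => lt.
  by rewrite ffunE val_insubd lt.
have enc_inj : {in [predC [pred b | nonreduced b]] &, injective enc}.
  move=> a b; rewrite !inE => na nb eab; apply: mon_inj.
  have e i : mon a (lift ord0 i) = mon b (lift ord0 i).
    by rewrite -!encE // eab.
  apply/mnmP => i; case: (unliftP ord0 i) => [j ->|->]; first exact: e.
  have := mdeg_mon a; rewrite -(mdeg_mon b) !mdegE !big_ord_recl /=.
  by under eq_bigr do rewrite e; move/addIn.
rewrite -(card_in_image enc_inj) (leq_trans (max_card _)) // card_dep_ffun foldrE big_image /=.
by apply: eq_leq; apply: eq_bigr => i _; rewrite card_ord.
Qed.

(** The D + 1 monomials in x_j and x_i alone, and one multiple of a perturbed
    form for each monomial in N, are more than the monomials of degree D: there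
    is a linear relation over k. It must involve the first ones, for a relation
    between the multiples would make t an eigenvalue of a matrix over E. Scaled
    so that these coefficients do not all vanish at t = 0, it gives a binary form
    in the limit ideal. *)
Lemma limit_ideal_dependent i j : exists Q : {poly E},
  [/\ Q != 0, (size Q <= D.+1)%N & limit_ideal d f tf (binary_form 'X_j 'X_i Q D)].
Proof.
pose F := generic_form d f tf.
have /fin_all_exists [s hs] : forall b : N, exists l : 'I_r, (d l <= mon (val b) (lift ord0 l))%N.
  by case=> b /= /existsP.
pose red (b : N) : 'X_{1..n} := (mon (val b) - U_(lift ord0 (s b)) *+ d (s b))%MM.
have redE b : (red b + U_(lift ord0 (s b)) *+ d (s b))%MM = mon (val b).
  rewrite submK //; apply/mnm_lepP => l; rewrite mulmnE mnm1E.
  by case: eqP => [<-|]; rewrite ?mul1n // hs.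
pose G (a : 'I_D.+1 + N) : {mpoly k[n]} :=
  match a with inl l => 'X_j ^+ l * 'X_i ^+ (D - l) | inr b => 'X_[red b] * F (s b) end.
pose P (a : N) : {mpoly E[n]} := 'X_[red a] * f (s a).
have GE b : G (inr b) = tf 'X *: 'X_[mon (val b)] - map_mpoly (tf \o polyC) (P b).
  have -> : map_mpoly (tf \o polyC) (P b) = 'X_[red b] * map_mpoly (tf \o polyC) (f (s b)).
    by rewrite rmorphM /= map_mpolyX.
  rewrite -redE mpolyXD scalerAr -mulrBr; congr (_ * _); rewrite -mpolyXn.
  apply/mpolyP => a; rewrite mcoeff_map_mpoly !mcoeffB mcoeffZ mcoeff_map_mpoly /=.
  rewrite mcoeffZ mcoeff_map_mpoly rmorphB rmorphM /=; congr (_ * _ - _).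
  by rewrite !mpolyXn !mcoeffX rmorph_nat.
have G_homog a : G a \is D.-homog.
  case: a => [l|b] /=.
    have hD : (1 * l + 1 * (D - l) = D)%N by rewrite !mul1n subnKC // -ltnS.
    rewrite -[X in X.-homog]hD.
    by apply: dhomogM; apply: dhomogMn; rewrite dhomogX; apply/eqP; exact: mdeg1.
  have <- : (mdeg (red b) + d (s b))%N = D.
    by rewrite -(mdeg_mon (val b)) -redE mdegD mdegMn mdeg1 mul1n.
  by apply: dhomogM; [rewrite dhomogX | exact: generic_form_homog].
have [|x [x0 hx]] := @lin_sys_nontrivial k ('I_D.+1 + N)%type B (fun a b => (G a)@_(mon b)).
  by rewrite card_sum card_ord addSn ltnS card_monomials_le.
have sumG : \sum_a x a *: G a = 0.
  apply/mpolyP => c; rewrite mcoeff0.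
  have [cD|cD] := eqVneq (mdeg c) D; last first.
    by apply: dhomog_nemf_coeff cD; apply: rpred_sum => a _; apply: rpredZ.
  have lt : (mdeg c < D.+1)%N by rewrite cD.
  have h : mdeg (BMultinom lt : 'X_{1..n < D.+1}) == D by rewrite /= cD.
  rewrite -[RHS](hx (exist _ (BMultinom lt) h)) (raddf_sum (mcoeff c)) /=.
  by apply: eq_bigr => a _; rewrite mcoeffZ.
have kappa0 : exists l, x (inl l) != 0.
  apply: contrapT => nex.
  have xl l : x (inl l) = 0 by apply/eqP; apply: contraT => xl; case: nex; exists l.
  pose v := \row_(b < #|{: N}|) x (inr (enum_val b)).
  pose M := \matrix_(a < #|{: N}|, b < #|{: N}|) (P (enum_val a))@_(mon (val (enum_val b))).
  have vM : v *m map_mx (tf \o polyC) M = tf 'X *: v.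
    apply/rowP => b; rewrite !mxE.
    have := hx (val (enum_val b)); rewrite big_sumType /= big1 ?add0r => [|l _]; last first.
      by rewrite xl mul0r.
    under eq_bigr do rewrite -/(G (inr _)) GE mcoeffB mulrBr.
    rewrite sumrB => /eqP; rewrite subr_eq0 => /eqP e.
    transitivity (\sum_(a : N) x (inr a) * (map_mpoly (tf \o polyC) (P a))@_(mon (val (enum_val b)))).
      rewrite [RHS](reindex (@enum_val _ (mem N))) /=; last exact/onW_bij/enum_val_bij.
      by apply: eq_bigr => a _; rewrite !mxE mcoeff_map_mpoly.
    rewrite -e (bigD1 (enum_val b)) //= mcoeffZ mcoeffX eqxx mulr1 big1 ?addr0 1?mulrC //.
    move=> a /negbTE ab; rewrite mcoeffZ mcoeffX (inj_eq mon_inj) -val_eqE /= in ab *.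
    by rewrite ab !mulr0.
  have v0 : v != 0.
    case: x0 => -[l|b] xb; first by rewrite xl eqxx in xb.
    apply: contraNneq xb => /rowP /(_ (enum_rank b)).
    by rewrite !mxE enum_rankK => ->.
  have : eigenvalue (map_mx (tf \o polyC) M) (tf 'X) by apply/eigenvalueP; exists v.
  rewrite eigenvalue_root_char -map_char_poly /root map_poly_comp horner_map /=.
  rewrite -[_.['X]]/(_ \Po 'X) comp_polyXr -(rmorph0 tf) (inj_eq tf_inj).
  by apply/negP/monic_neq0/char_poly_monic.
have Jk : ideal F (\sum_l x (inl l) *: G (inl l)).
  move: sumG; rewrite big_sumType /= => /eqP; rewrite addr_eq0 => /eqP ->.
  apply: is_idealN; first exact: is_ideal_ideal.
  apply: is_ideal_sum => [|b _]; first exact: is_ideal_ideal.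
  apply: is_idealZ; first exact: is_ideal_ideal.
  by have [_ _ JM] := is_ideal_ideal F; apply: JM; exact: ideal_gen.
have [c [u [[l0 ul0] hu]]] := clear_at0 kappa0.
exists (\poly_(l < D.+1) (u (inord l)).[0]); split; last 1 first.
- exists (\sum_l u l *: ('X_j ^+ l * 'X_i ^+ (D - l))); split.
    have -> : map_mpoly tf (\sum_l u l *: ('X_j ^+ l * 'X_i ^+ (D - l)))
            = c *: \sum_l x (inl l) *: G (inl l).
      rewrite rmorph_sum scaler_sumr; apply: eq_bigr => l _ /=.
      by rewrite scalerA -hu map_mpolyZ rmorphM !rmorphXn /= !map_mpolyX.
    by apply: is_idealZ => //; exact: is_ideal_ideal.
  rewrite rmorph_sum; apply: eq_bigr => l _ /=.
  rewrite map_mpolyZ rmorphM !rmorphXn /= !map_mpolyX coef_poly ltn_ord inord_val.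
  by [].
- apply: contraNneq ul0 => /polyP /(_ l0).
  by rewrite coef_poly ltn_ord inord_val coef0 => ->.
- exact: size_poly.
Qed.
End BezoutDependence.

(** The limit ideal contains the f i; in it some x_i is not nilpotent, and the
    ratios x_j / x_i satisfy equations of degree \prod_i d i over E, which allow
    to choose a zero coordinate by coordinate. *)
Theorem bezout_rational_zero (E : fieldType) (r : nat) (d : 'I_r -> nat)
    (f : 'I_r -> {mpoly E[r.+1]}) :
  (forall i, (0 < d i)%N) -> (forall i, f i \is (d i).-homog) ->
  (forall p : {poly E}, (1 < size p <= (\prod_i d i).+1)%N -> exists x, root p x) ->
  exists c : 'I_r.+1 -> E, (exists i, c i != 0) /\ forall i, (f i).@[c] = 0.
Proof.
move=> d_gt0 f_homog rootE.
have tf_inj : injective (@FracField.tofrac {poly E}) by move=> x y /eqP; rewrite tofrac_eq => /eqP.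
pose L := limit_ideal d f (@FracField.tofrac {poly E}).
have IL : is_ideal L by apply: is_ideal_limit.
have [i ni] : exists i, nonnilpotent i L := nonnilpotent_variable d_gt0 f_homog tf_inj.
have [|c [ci hc]] := ideal_rational_zero rootE IL ni.
  by move=> j; apply: limit_ideal_dependent => //; exact: normalize_at0.
exists c; split; first by exists i; rewrite ci oner_neq0.
by move=> j; apply: (hc (d j)); [exact: f_homog | exact: limit_ideal_gen].
Qed.

(** * Gradings *)

Section Graded.

(** Homogeneity is a family of predicates, so that one argument for substitutions
    and determinants covers forms as well as polynomials whose coefficients are
    forms. *)
Definition graded (A : comNzRingType) (gr : nat -> A -> Prop) : Prop :=
  [/\ forall m, gr m 0, forall m x y, gr m x -> gr m y -> gr m (x + y),
      forall m x, gr m x -> gr m (- x), gr 0%N 1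
    & forall m l x y, gr m x -> gr l y -> gr (m + l)%N (x * y)].

Lemma graded_prod (A : comNzRingType) (gr : nat -> A -> Prop) (I : Type) (s : seq I)
    (P : pred I) (e : I -> nat) (h : I -> A) :
  graded gr -> (forall i, P i -> gr (e i) (h i)) ->
  gr (\sum_(i <- s | P i) e i)%N (\prod_(i <- s | P i) h i).
Proof.
case=> _ _ _ gr1 grM H; elim/big_rec2: _ => // i x y Pi; apply: grM; exact: H.
Qed.

Lemma graded_sum (A : comNzRingType) (gr : nat -> A -> Prop) (I : Type) (s : seq I)
    (P : pred I) (h : I -> A) m :
  graded gr -> (forall i, P i -> gr m (h i)) -> gr m (\sum_(i <- s | P i) h i).
Proof. by case=> gr0 grD _ _ _ H; elim/big_ind: _ => //; apply: grD. Qed.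

Lemma gradedX (A : comNzRingType) (gr : nat -> A -> Prop) m x k :
  graded gr -> gr m x -> gr (k * m)%N (x ^+ k).
Proof.
case=> _ _ _ gr1 grM H; elim: k => // k IH; by rewrite exprS mulSn; apply: grM.
Qed.

Lemma graded_mmap (E : comNzRingType) (N d : nat) (A : comNzRingType)
    (gr : nat -> A -> Prop) (f : {rmorphism E -> A}) (h : 'I_N -> A) (p : {mpoly E[N]}) :
  graded gr -> (forall c, gr 0%N (f c)) -> (forall i, gr 1%N (h i)) ->
  p \is d.-homog -> gr d (mmap f h p).
Proof.
move=> Hgr grf grh /dhomogP hp; rewrite /mmap big_seq; apply: graded_sum => // a ap.
case: (Hgr) => _ _ _ _ grM; rewrite -[d]add0n; apply: (grM 0%N d); first exact: grf.
have <- : mdeg a = d := hp _ ap.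
rewrite mdegE /mmap1; apply: (graded_prod (gr := gr)) => // i _.
by have := gradedX (a i) Hgr (grh i); rewrite muln1.
Qed.

Lemma rmorph_mmap (R A B : comNzRingType) (N : nat) (phi : {rmorphism A -> B})
    (f : R -> A) (h : 'I_N -> A) (p : {mpoly R[N]}) :
  phi (mmap f h p) = mmap (phi \o f) (phi \o h) p.
Proof.
rewrite /mmap rmorph_sum; apply: eq_bigr => a _.
rewrite rmorphM rmorph_prod; congr (_ * _); apply: eq_bigr => i _.
by rewrite rmorphXn.
Qed.

Lemma eq_mmap (R A : nzRingType) (N : nat) (f f' : R -> A) (h h' : 'I_N -> A) p :
  f =1 f' -> h =1 h' -> mmap f h p = mmap f' h' p.
Proof.
move=> ef eh; apply: eq_bigr => a _; rewrite ef; congr (_ * _).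
by apply: eq_bigr => i _; rewrite eh.
Qed.

Lemma dhomogC (R : comNzRingType) n (c : R) : (c%:MP : {mpoly R[n]}) \is 0.-homog.
Proof. by rewrite -[c%:MP]mulr1 mul_mpolyC; apply: rpredZ; exact: dhomog1. Qed.

Lemma graded_homog (R : comNzRingType) n :
  graded (fun m (p : {mpoly R[n]}) => p \is m.-homog).
Proof.
split.
- by move=> m; exact: rpred0.
- by move=> m x y; exact: rpredD.
- by move=> m x; rewrite rpredN.
- exact: dhomog1.
- by move=> m l x y; exact: dhomogM.
Qed.

(** In {poly {mpoly R[n]}} the outer variable is counted in the total degree. *)
Definition total_homog (R : comNzRingType) n m (P : {poly {mpoly R[n]}}) : Prop :=
  forall i, ((i <= m)%N -> P`_i \is (m - i).-homog) /\ ((m < i)%N -> P`_i = 0).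

Lemma graded_total_homog (R : comNzRingType) n : graded (@total_homog R n).
Proof.
split.
- by move=> m i; rewrite coef0 rpred0.
- move=> m P Q HP HQ i; rewrite coefD; have [P1 P2] := HP i; have [Q1 Q2] := HQ i.
  by split=> h; [rewrite rpredD ?P1 ?Q1 | rewrite P2 ?Q2 ?addr0].
- move=> m P HP i; rewrite coefN; have [P1 P2] := HP i.
  by split=> h; [rewrite rpredN P1 | rewrite P2 ?oppr0].
- move=> i; rewrite coef1; case: i => [|i]; split=> //.
  by rewrite sub0n eqxx => _; exact: dhomog1.
move=> m l P Q HP HQ i; rewrite coefM; split=> hi.
  apply: rpred_sum => j _; have [P1 P2] := HP j; have [Q1 Q2] := HQ (i - j)%N.
  case: (leqP j m) => jm; last by rewrite P2 // mul0r rpred0.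
  case: (leqP (i - j) l) => jl; last by rewrite Q2 // mulr0 rpred0.
  have e : ((m - j) + (l - (i - j)) = m + l - i)%N by have := ltn_ord j; lia.
  by rewrite -e; apply: dhomogM; [exact: P1 | exact: Q1].
apply: big1 => j _; have [P1 P2] := HP j; have [Q1 Q2] := HQ (i - j)%N.
case: (leqP j m) => jm; last by rewrite P2 // mul0r.
by rewrite Q2 ?mulr0 //; have := ltn_ord j; lia.
Qed.

Lemma total_homogC (R : comNzRingType) n m (p : {mpoly R[n]}) :
  p \is m.-homog -> total_homog m p%:P.
Proof.
by move=> hp i; rewrite coefC; case: i => [|i]; split=> //= _; rewrite ?subn0 // rpred0.
Qed.

Lemma total_homogX (R : comNzRingType) n : total_homog 1 ('X : {poly {mpoly R[n]}}).
Proof.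
move=> i; rewrite coefX; case: i => [|[|i]]; split=> //= _; rewrite ?rpred0 //.
exact: dhomog1.
Qed.

Lemma homog0_const (R : comNzRingType) n (p : {mpoly R[n]}) : p \is 0.-homog ->
  p = (p@_0)%:MP.
Proof.
move=> /dhomogP hp; apply/mpolyP => a; rewrite mcoeffC.
case: (eqVneq 0%MM a) => [<-|a0]; rewrite ?mulr1 // mulr0.
apply: memN_msupp_eq0; apply: contraNN a0 => /hp /eqP.
by rewrite /= mdeg_eq0 eq_sym.
Qed.

Lemma homog_linE (R : comNzRingType) n (p : {mpoly R[n]}) : p \is 1.-homog ->
  p = \sum_i p@_U_(i) *: 'X_i.
Proof.
move=> /dhomogP hp; apply/mpolyP => a; rewrite raddf_sum /=.
have [ap|/memN_msupp_eq0 ap] := boolP (a \in msupp p).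
  have /eqP := hp _ ap; rewrite mdeg_eq1 => /existsP [i /eqP ->].
  rewrite (bigD1 i) //= mcoeffZ mcoeffX eqxx mulr1 big1 ?addr0 // => j /negbTE ji.
  rewrite mcoeffZ mcoeffX; case: eqP => [/mnmP /(_ j)|]; last by rewrite mulr0.
  by rewrite !mnm1E eqxx eq_sym ji.
rewrite ap big1 // => i _; rewrite mcoeffZ mcoeffX.
by case: eqP => [->|_]; rewrite ?ap ?mul0r ?mulr0.
Qed.

End Graded.

(** * Linear spaces of common zeros *)

Section LinearZeros.
Variable E : fieldType.
Implicit Types (s t : seq nat).

Definition vanishes k N (p : {mpoly E[N]}) (A : 'M[E]_(k, N)) : Prop :=
  forall v : 'rV_k, p.@[(v *m A) 0] = 0.

(** Each form carries its degree, since the zero form has all degrees. The space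
    of common zeros is the row space of A, of dimension k. *)
Definition linear_zeros s k N : Prop :=
  forall fs : seq (nat * {mpoly E[N]}), perm_eq (unzip1 fs) s ->
    (forall x, x \in fs -> x.2 \is x.1.-homog) ->
    exists A : 'M[E]_(k, N), row_free A /\ forall x, x \in fs -> vanishes x.2 A.

Lemma linear_zeros_perm s t k N : perm_eq s t -> linear_zeros s k N -> linear_zeros t k N.
Proof. by move=> st H fs fst; apply: H; rewrite (perm_trans fst) // perm_sym. Qed.

Definition subst_rows k N (A : 'M[E]_(k, N)) (p : {mpoly E[N]}) : {mpoly E[k]} :=
  p \mPo [tuple \sum_i A i j *: 'X_i | j < N].

Lemma subst_rows_eval k N (A : 'M[E]_(k, N)) p (v : 'rV_k) :
  (subst_rows A p).@[v 0] = p.@[(v *m A) 0].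
Proof.
rewrite comp_mpoly_meval; apply: meval_eq => j; rewrite tnth_mktuple mxE raddf_sum.
by apply: eq_bigr => i _; rewrite /= mevalZ mevalXU mulrC.
Qed.

Lemma subst_rows_homog k N (A : 'M[E]_(k, N)) p d :
  p \is d.-homog -> subst_rows A p \is d.-homog.
Proof.
apply: (graded_mmap (graded_homog E k)) => [c|j].
  exact: dhomogC.
rewrite tnth_mktuple; apply: rpred_sum => i _; apply: rpredZ.
by rewrite dhomogX; apply/eqP; exact: mdeg1.
Qed.

Lemma perm_unzip1_split (T : eqType) (fs : seq (nat * T)) s : perm_eq (unzip1 fs) s ->
  exists2 gs, perm_eq fs gs & unzip1 gs = s.
Proof.
elim: s fs => [|d s IH] fs fss.
  by exists [::] => //; have := perm_size fss; rewrite size_map; case: fs {fss}.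
have /mapP [x xfs ed] : d \in unzip1 fs by rewrite (perm_mem fss) mem_head.
have fse := perm_to_rem xfs.
have [|gs fg eg] := IH (rem x fs).
  by rewrite -(perm_cons d) -(permPr fss) {1}ed -map_cons perm_sym perm_map.
exists (x :: gs); last by rewrite /= ed eg.
by apply: perm_trans fse _; rewrite perm_cons.
Qed.

(** The forms with degrees in t are restricted to the space found for s. *)
Lemma linear_zeros_cat s t k m N :
  linear_zeros s m N -> linear_zeros t k m -> linear_zeros (s ++ t) k N.
Proof.
move=> Hs Ht fs /perm_unzip1_split [gs fg egs] hfs.
have gcat := cat_take_drop (size s) gs.
have e1 : unzip1 (take (size s) gs) = s by rewrite /unzip1 map_take -/(unzip1 gs) egs take_size_cat.
have e2 : unzip1 (drop (size s) gs) = t by rewrite /unzip1 map_drop -/(unzip1 gs) egs drop_size_cat.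
have sub1 x : x \in take (size s) gs -> x \in fs by move=> /mem_take; rewrite (perm_mem fg).
have sub2 x : x \in drop (size s) gs -> x \in fs by move=> /mem_drop; rewrite (perm_mem fg).
have [|x /sub1/hfs|A [fA hA]] := Hs (take (size s) gs); rewrite ?e1 //.
pose ts := [seq (x.1, subst_rows A x.2) | x <- drop (size s) gs].
have [||B [fB hB]] := Ht ts.
- by rewrite /unzip1 -map_comp -e2.
- by move=> _ /mapP [x /sub2/hfs hx ->]; exact: subst_rows_homog.
exists (B *m A); split; first by rewrite /row_free mxrankMfree.
move=> x; rewrite (perm_mem fg) -gcat mem_cat => /orP [xs|xt] v.
  by rewrite mulmxA; exact: hA.
rewrite mulmxA -subst_rows_eval.
by apply: (hB (x.1, subst_rows A x.2)); apply: map_f.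
Qed.

Lemma row_free_pid k N : (k <= N)%N -> row_free (pid_mx k : 'M[E]_(k, N)).
Proof. by move=> kN; rewrite /row_free rank_pid_mx. Qed.

Lemma linear_zeros_nil k N : (k <= N)%N -> linear_zeros [::] k N.
Proof.
move=> kN fs fs0 _; exists (pid_mx k); split; first exact: row_free_pid.
by have := perm_size fs0; rewrite size_map; case: fs {fs0}.
Qed.

Lemma exists_row_free_sub m n (B : 'M[E]_(m, n)) k : (k <= \rank B)%N ->
  exists A : 'M[E]_(k, n), row_free A /\ (A <= B)%MS.
Proof.
move=> kB; exists ((pid_mx k : 'M_(k, \rank B)) *m row_base B); split.
  by rewrite /row_free mxrankMfree ?row_base_free ?rank_pid_mx.
by rewrite mulmx_sub // eq_row_base.
Qed.

Lemma linear_zeros1 N : linear_zeros [:: 1%N] N N.+1.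
Proof.
move=> fs /perm_unzip1_split [[|x [|y gs]] fg] //= [ex] hfs.
pose c : 'cV[E]_N.+1 := \col_i x.2@_U_(i).
have hx : x.2 \is 1.-homog by rewrite -ex; apply: hfs; rewrite (perm_mem fg) mem_head.
have [|A [fA Ac]] := @exists_row_free_sub _ _ (kermx c) N.
  by rewrite mxrank_ker; have := rank_leq_col c; lia.
exists A; split=> // y; rewrite (perm_mem fg) inE => /eqP -> v.
rewrite (homog_linE hx) raddf_sum /=.
transitivity ((v *m A *m c) 0 0).
  by rewrite mxE; apply: eq_bigr => i _; rewrite mevalZ mevalXU mulrC [c _ _]mxE.
by rewrite -mulmxA (sub_kermxP Ac) mulmx0 mxE.
Qed.

Lemma linear_zeros_linear a s k N : linear_zeros s k N ->
  linear_zeros (nseq a 1%N ++ s) k (a + N).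
Proof.
move=> H; elim: a => // a IH; apply: (@linear_zeros_cat [:: 1%N]) IH.
by rewrite addSn; apply: linear_zeros1.
Qed.

Lemma linear_zeros_bezout s D : all (leq 1) s -> (\prod_(d <- s) d <= D)%N ->
  (forall p : {poly E}, (1 < size p <= D.+1)%N -> exists x, root p x) ->
  linear_zeros s 1 (size s).+1.
Proof.
move=> s0 sD rootE fs fss hfs.
pose x0 : nat * {mpoly E[(size s).+1]} := (0%N, 0).
have sfs : size fs = size s by have := perm_size fss; rewrite size_map.
have mem_nth (i : 'I_(size s)) : nth x0 fs i \in fs by rewrite mem_nth ?sfs.
have [|||c [[i ci] hc]] := @bezout_rational_zero E (size s)
    (fun i => (nth x0 fs i).1) (fun i => (nth x0 fs i).2).
- move=> i; have /allP := s0; apply; rewrite -(perm_mem fss).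
  by apply: map_f.
- by move=> i; apply: hfs.
- move=> p /andP [p1 p2]; apply: rootE; rewrite p1 (leq_trans p2) // ltnS.
  rewrite (leq_trans _ sD) // -(perm_big _ fss) /= big_map (big_nth x0) sfs big_mkord.
  exact: leqnn.
exists (\row_j c j); split.
  rewrite /row_free eqn_leq rank_leq_row lt0n mxrank_eq0 /=.
  by apply: contraNneq ci => /rowP /(_ i); rewrite !mxE => ->.
move=> x xfs v; have ix : (index x fs < size s)%N by have := xfs; rewrite -index_mem sfs.
have := hc (Ordinal ix); rewrite /= nth_index // => h.
have hx := hfs x xfs.
rewrite (_ : v *m _ = v 0 0 *: \row_j c j); last first.
  by apply/rowP => j; rewrite !mxE big_ord1 mxE.
transitivity (v 0 0 ^+ x.1 * x.2.@[c]); last by rewrite h mulr0.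
rewrite !mevalE mulr_sumr !big_seq; apply: eq_bigr => a ax.
have <- : mdeg a = x.1 by move/dhomogP: hx; apply.
rewrite mulrCA mdegE -prodrXr -big_split /=; congr (_ * _); apply: eq_bigr => j _.
by rewrite !mxE exprMn.
Qed.

(** A form of degree d has polars of degrees 1, ..., d at a point; the one of
    degree d is the restriction of the form to a complement of the point. *)
Definition polars s : seq nat := flatten [seq iota 1 d | d <- s].

Section Cone.
Variables (k N : nat) (q : 'rV[E]_N.+1) (C : 'M[E]_(N, N.+1)).

(** The expansion of p (y q + w C) in powers of y, where q is a point and the
    rows of C span a complement: its coefficients are the polars of p at q. *)
Definition cone_poly (p : {mpoly E[N.+1]}) : {poly {mpoly E[N]}} :=
  mmap (@polyC _ \o @mpolyC N E)
    (fun j => (q 0 j)%:MP%:P * 'X + (\sum_i C i j *: 'X_i)%:P) p.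

Lemma cone_poly_homog d p : p \is d.-homog -> total_homog d (cone_poly p).
Proof.
have Hgr := graded_total_homog E N; have [_ grD _ _ grM] := Hgr.
have grC c : total_homog 0 ((c%:MP : {mpoly E[N]})%:P).
  by apply: total_homogC; exact: dhomogC.
apply: (graded_mmap Hgr) => // j; apply: grD.
  by apply: (grM 0%N 1%N) => //; exact: total_homogX.
apply: total_homogC; apply: rpred_sum => i _; apply: rpredZ.
by rewrite dhomogX; apply/eqP; exact: mdeg1.
Qed.

Lemma cone_poly_eval p (w : 'rV_N) (y : E) :
  p.@[(y *: q + w *m C) 0] = \sum_(i < size (cone_poly p)) ((cone_poly p)`_i).@[w 0] * y ^+ i.
Proof.
pose phi : {rmorphism {poly {mpoly E[N]}} -> E} := horner_eval y \o map_poly (meval (w 0)).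
transitivity (phi (cone_poly p)); last first.
  rewrite /= /horner_eval (@horner_coef_wide _ (size (cone_poly p))) ?size_poly //.
  by apply: eq_bigr => i _; rewrite coef_map.
apply: (etrans _ (esym (rmorph_mmap phi _ _ _))); apply: eq_mmap => [c|j] /=; rewrite /horner_eval.
  by rewrite map_polyC hornerC /= mevalC.
rewrite rmorphD rmorphM /= map_polyX !map_polyC hornerD hornerM hornerX !hornerC /= mevalC.
rewrite !mxE mulrC raddf_sum; congr (_ + _); apply: eq_bigr => i _.
by rewrite /= mevalZ mevalXU mulrC.
Qed.

End Cone.

(** Let q be a common zero. On a k-dimensional subspace of a complement of q
    where all the polars at q vanish, each form p satisfies
    p (y q + w) = p(q) y^d = 0, so it vanishes on the span with q. *)
Lemma linear_zeros_cone s k N :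
  linear_zeros s 1 N.+1 -> linear_zeros (polars s) k N -> linear_zeros s k.+1 N.+1.
Proof.
move=> Hs Hp fs fss hfs.
have [q [fq hq]] := Hs fs fss hfs.
have [|C [fC Cq]] := @exists_row_free_sub _ _ (q^C)%MS N.
  by rewrite mxrank_compl (eqP fq) subSS subn0.
pose ps x := [seq (j, (cone_poly q C x.2)`_(x.1 - j)) | j <- iota 1 x.1].
have [||A [fA hA]] := Hp (flatten [seq ps x | x <- fs]).
- rewrite /unzip1 map_flatten -map_comp (@eq_map _ _ _ (fun x => iota 1 x.1)).
    rewrite (map_comp (iota 1) fst); apply: perm_flatten; exact: perm_map.
  by move=> x; rewrite /= -map_comp map_id_in.
- move=> _ /flattenP [_ /mapP [x xfs ->] /mapP [j jx ->]] /=.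
  move: jx; rewrite mem_iota add1n ltnS => /andP [_ jx].
  have [+ _] := cone_poly_homog q C (hfs x xfs) (x.1 - j)%N.
  by rewrite leq_subr subKn //; apply.
exists (col_mx q (A *m C)); split.
  rewrite /row_free -[k.+1]/(1 + k)%N -addsmxE mxrank_disjoint_sum.
    by rewrite mxrankMfree // (eqP fq) (eqP fA).
  apply/eqP; rewrite -submx0 -(capmx_compl q); apply: capmxS => //.
  exact: mulmx_sub.
move=> x xfs; rewrite /vanishes -[k.+1]/(1 + k)%N => v.
rewrite -[v]hsubmxK mul_row_col mulmxA.
have -> : lsubmx v *m q = lsubmx v 0 0 *: q.
  by apply/rowP => j; rewrite [LHS]mxE big_ord1 [RHS]mxE.
have hpos (w : 'rV_k) j : (j < x.1)%N -> ((cone_poly q C x.2)`_j).@[(w *m A) 0] = 0.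
  move=> jx; apply: (hA ((x.1 - j)%N, (cone_poly q C x.2)`_j)).
  apply/flattenP; exists (ps x); first exact: map_f.
  apply/mapP; exists (x.1 - j)%N; first by rewrite mem_iota subn_gt0 jx add1n ltnS leq_subr.
  by rewrite subKn // ltnW.
have hgt j : (x.1 < j)%N -> (cone_poly q C x.2)`_j = 0.
  by have [_] := cone_poly_homog q C (hfs x xfs) j.
have [c hc] : exists c, (cone_poly q C x.2)`_x.1 = c%:MP.
  have [+ _] := cone_poly_homog q C (hfs x xfs) x.1.
  by rewrite leqnn subnn => /(_ isT)/homog0_const ->; eexists.
have ev (w : 'rV_k) y : x.2.@[(y *: q + w *m A *m C) 0] = c * y ^+ x.1.
  rewrite cone_poly_eval.
  transitivity (\sum_(i < maxn (size (cone_poly q C x.2)) x.1.+1)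
                  ((cone_poly q C x.2)`_i).@[(w *m A) 0] * y ^+ i).
    rewrite (big_ord_widen _ (fun i => ((cone_poly q C x.2)`_i).@[(w *m A) 0] * y ^+ i) (leq_maxl _ x.1.+1)).
    rewrite big_mkcond; apply: eq_bigr => i _; case: ltnP => // hi.
    by rewrite nth_default // raddf0 mul0r.
  have lt : (x.1 < maxn (size (cone_poly q C x.2)) x.1.+1)%N by rewrite leq_maxr.
  rewrite (bigD1 (Ordinal lt)) //= hc mevalC big1 ?addr0 // => i ix.
  case: (ltngtP i x.1) => hi; first by rewrite hpos // mul0r.
    by rewrite hgt // raddf0 mul0r.
  by case/eqP: ix; apply: val_inj.
have c0 : c = 0.
  have := ev 0 1; rewrite scale1r !mul0mx addr0 expr1n mulr1 => <-.
  have := hq x xfs (const_mx 1); rewrite (_ : _ *m q = q) //.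
  by apply/rowP => j; rewrite !mxE big_ord1 mxE mul1r.
by rewrite ev c0 mul0r.
Qed.

End LinearZeros.

(** * Spaces of zeros of forms of degree at most four *)

Definition has_roots (E : fieldType) (D : nat) : Prop :=
  forall p : {poly E}, (1 < size p <= D.+1)%N -> exists x, root p x.

Definition low_degrees (a b c e : nat) : seq nat :=
  nseq a 1%N ++ nseq b 2%N ++ nseq c 3%N ++ nseq e 4%N.

Lemma perm_polars_low a b c e :
  perm_eq (polars (low_degrees a b c e))
    (low_degrees (a + b + c + e) (b + c + e) (c + e) e).
Proof.
apply/seq.permP => p; rewrite /low_degrees /polars !map_cat !flatten_cat !count_cat !count_nseq.
have cnt d n : count p (flatten [seq iota 1 i | i <- nseq n d]) = (n * count p (iota 1 d))%N.
  by elim: n => // n IH; rewrite /= count_cat IH mulSn.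
by rewrite !cnt /=; case: (p 1%N); case: (p 2%N); case: (p 3%N); case: (p 4%N) => /=; lia.
Qed.

Section LowDegrees.
Variables (E : fieldType) (D : nat).
Hypothesis rootE : has_roots E D.
Hypothesis D4 : (4 <= D)%N.

(** All the quadrics but one are made to vanish on a line, which a polar cone
    gives from a point; the last one is solved on this line. *)
Lemma quadrics_point q N : (q * q.+1 + 2 <= 2 * N)%N -> linear_zeros E (nseq q 2%N) 1 N.
Proof.
elim: q N => [|q IH] N hN; first by apply: linear_zeros_nil; lia.
rewrite -addn1 nseqD; apply: (@linear_zeros_cat _ _ _ _ 2); last first.
  apply: (@linear_zeros_bezout _ [:: 2%N] D) => //; rewrite big_seq1; lia.
case: N hN => [|N] hN; first lia.
apply: linear_zeros_cone; first by apply: IH; lia.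
apply: linear_zeros_perm (_ : linear_zeros E (nseq q 1%N ++ nseq q 2%N) 1 N).
  have := perm_polars_low 0 q 0 0; rewrite /low_degrees /= !cats0 !addn0 add0n.
  by rewrite perm_sym.
have -> : N = (q + (N - q))%N by lia.
by apply: linear_zeros_linear; apply: IH; lia.
Qed.

Lemma quadrics_space q k N : (q * q.+1 + 2 + 2 * k * q.+1 <= 2 * N)%N ->
  linear_zeros E (nseq q 2%N) k.+1 N.
Proof.
elim: k N => [|k IH] N hN; first by apply: quadrics_point; lia.
case: N hN => [|N] hN; first lia.
apply: linear_zeros_cone; first by apply: quadrics_point; lia.
apply: linear_zeros_perm (_ : linear_zeros E (nseq q 1%N ++ nseq q 2%N) k.+1 N).
  have := perm_polars_low 0 q 0 0; rewrite /low_degrees /= !cats0 !addn0 add0n.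
  by rewrite perm_sym.
have -> : N = (q + (N - q))%N by lia.
by apply: linear_zeros_linear; apply: IH; lia.
Qed.

(** Bezout's theorem solves the cubics on a space of dimension c + 1 where the
    quadrics vanish. *)
Lemma cubics_point b c N : (3 ^ c <= D)%N -> (b * b.+1 + 2 + 2 * c * b.+1 <= 2 * N)%N ->
  linear_zeros E (nseq b 2%N ++ nseq c 3%N) 1 N.
Proof.
move=> hc hN; apply: linear_zeros_cat (quadrics_space hN) _.
have -> : c.+1 = (size (nseq c 3%N)).+1 by rewrite size_nseq.
apply: (@linear_zeros_bezout _ _ D) => //; first by rewrite all_nseq orbT.
by rewrite big_nseq iter_muln muln1.
Qed.

Lemma cubics_line b c N : (3 ^ c <= D)%N ->
  (2 * (b + c).+1 + (b + c) * (b + c).+1 + 2 + 2 * c * (b + c).+1 <= 2 * N)%N ->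
  linear_zeros E (nseq b 2%N ++ nseq c 3%N) 2 N.
Proof.
move=> hc; case: N => [|N] hN; first lia.
have hbc : (b * b.+1 <= (b + c) * (b + c).+1)%N by apply: leq_mul; lia.
have hcb : (2 * c * b.+1 <= 2 * c * (b + c).+1)%N by apply: leq_mul; lia.
apply: linear_zeros_cone; first by apply: cubics_point => //; lia.
apply: linear_zeros_perm (_ : linear_zeros E (nseq (b + c) 1%N ++ nseq (b + c) 2%N ++ nseq c 3%N) 1 N).
  have := perm_polars_low 0 b c 0; rewrite /low_degrees /= !cats0 !addn0 add0n.
  by rewrite perm_sym.
have -> : N = (b + c + (N - (b + c)))%N by lia.
apply: linear_zeros_linear; apply: cubics_point => //.
move: ((b + c) * _)%N (2 * c * _)%N hN {hbc hcb} => x y; lia.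
Qed.

(** Twice the number of variables that quartic_point uses, as the triangular
    number of b + c enters in it. *)
Definition quartic_bound a b c : nat :=
  (2 * a + 2 * (b + c).+1 + (b + c) * (b + c).+1 + 2 + 2 * c * (b + c).+1)%N.

(** The quartic is solved on a line where all the other forms vanish. *)
Lemma quartic_point a b c N : (3 ^ c <= D)%N -> (quartic_bound a b c <= 2 * N)%N ->
  linear_zeros E (low_degrees a b c 1) 1 N.
Proof.
rewrite /quartic_bound => hc hN.
have -> : N = (a + (N - a))%N by lia.
apply: linear_zeros_linear; rewrite catA; apply: (@linear_zeros_cat _ _ _ _ 2).
  by apply: cubics_line => //; move: ((b + c) * _)%N (2 * c * _)%N hN => x y; lia.
by apply: (@linear_zeros_bezout _ [:: 4%N] D) => //; rewrite big_seq1.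
Qed.

(** A computable test that k polar cones in a row have enough variables: each
    replaces the forms by their polars in one variable less. *)
Fixpoint quartic_room k a b c N : bool :=
  (quartic_bound a b c <= 2 * N)%N &&
  (if k is k'.+1 then quartic_room k' (a + b + c + 1) (b + c + 1) (c + 1) N.-1 else true).

(** The polars of one quartic contain a single quartic, so at each level the
    degree to be solved on a line is 4, while the number of cubics grows by one. *)
Lemma quartic_space k a b c N : (3 ^ (c + k) <= D)%N -> quartic_room k a b c N ->
  linear_zeros E (low_degrees a b c 1) k.+1 N.
Proof.
elim: k a b c N => [|k IH] a b c N hc /= /andP [hN room].
  by apply: quartic_point => //; rewrite addn0 in hc.
case: N hN room => [|N] hN room; first by move: hN; rewrite /quartic_bound; lia.
apply: linear_zeros_cone.
  by apply: quartic_point hN; apply: leq_trans hc; rewrite leq_exp2l // leq_addr.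
apply: linear_zeros_perm (IH _ _ _ _ _ room); first by rewrite perm_sym perm_polars_low.
by rewrite -addnA add1n.
Qed.

(** The forms of degree at least 5 are handled on a linear space of dimension
    l - 4 where those of degree at most 4 vanish; the product of the degrees left
    is (l-1)!/24. *)
Lemma tschirnhaus_room l N : (5 <= l)%N ->
  ((l.-1)`! <= 24 * D)%N -> (3 ^ (l - 4) <= D)%N -> quartic_room (l - 5) 1 1 1 N ->
  linear_zeros E (iota 1 l.-1) 1 N.
Proof.
move=> l5 hD h3 room.
have -> : iota 1 l.-1 = low_degrees 1 1 1 1 ++ iota 5 (l - 5).
  have -> : l.-1 = (4 + (l - 5))%N by lia.
  by rewrite iotaD.
apply: (@linear_zeros_cat _ _ _ _ (l - 5).+1).
  by apply: quartic_space room; rewrite add1n -subSn.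
rewrite -{2}[(l - 5)%N](size_iota 5); apply: (@linear_zeros_bezout _ _ D) => //.
  by apply/allP => x; rewrite mem_iota => /andP [x5 _]; apply: leq_trans x5.
rewrite -(leq_pmul2l (isT : (0 < 24)%N)); apply: leq_trans hD.
rewrite (_ : 24%N = 4`!) // (_ : l.-1 = (4 + (l - 5))%N); last lia.
elim: (l - 5)%N => [|j IHj]; first by rewrite big_nil muln1.
rewrite -[in X in (X <= _)%N](addn1 j) iotaD big_cat big_seq1 /= addnS factS mulnA mulnC.
exact: leq_mul.
Qed.

End LowDegrees.

(** * Tschirnhaus transformations *)

Section ResolventClosed.
Variables (C E : fieldType) (c : {rmorphism C -> E}).

(** A field with this property has nothing left to gain from d-parameter steps. *)
Definition resolvent_closed (d : nat) : Prop :=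
  forall (b : 'I_d -> E) (p : {poly E}), (1 < size p)%N ->
    (forall k, in_adjoin c b p`_k) -> exists x, root p x.

Lemma in_adjoin_var m (b : 'I_m -> E) i : in_adjoin c b (b i).
Proof. by exists 'X_i, 1; rewrite rmorph1 oner_neq0 divr1 mmapX mmap1U. Qed.

Lemma in_adjoin_const m (b : 'I_m -> E) z : in_adjoin c b (c z).
Proof. by exists z%:MP, 1; rewrite rmorph1 oner_neq0 divr1 mmapC. Qed.

(** Coefficients 0 and 1 cost no parameter. *)
Lemma root_of_few_coefs d (s : seq E) (p : {poly E}) : resolvent_closed d ->
  (size s <= d)%N -> (1 < size p)%N -> (forall k, p`_k \in [:: 0, 1 & s]) ->
  exists x, root p x.
Proof.
move=> cl sd sp hp; apply: (cl (fun i => nth 0 s i)) => // k.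
move: (hp k); rewrite !inE => /or3P [/eqP ->|/eqP ->|].
- by rewrite -(rmorph0 c); apply: in_adjoin_const.
- by rewrite -(rmorph1 c); apply: in_adjoin_const.
move=> ps; have lt : (index (p`_k)%R s < d)%N by apply: leq_trans sd; rewrite index_mem.
by have := in_adjoin_var (fun i : 'I_d => nth 0 s i) (Ordinal lt); rewrite /= nth_index.
Qed.

Lemma resolvent_closed_has_roots d : resolvent_closed d -> has_roots E d.
Proof.
move=> cl p /andP [p1 pd]; have p0 : p != 0 by rewrite -size_poly_gt0 ltnW.
have l0 : (lead_coef p)^-1 != 0 by rewrite invr_eq0 lead_coef_eq0.
pose q := (lead_coef p)^-1 *: p.
have sq : size q = size p by rewrite size_scale.
have [||||x rx] := @root_of_few_coefs d [seq q`_i | i <- iota 0 (size p).-1] q => //.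
- by rewrite size_map size_iota -ltnS (leq_trans _ pd) // ltn_predL ltnW.
- by rewrite sq.
- move=> k; rewrite !inE; case: (ltngtP k (size p).-1) => hk.
  + by apply/or3P/Or33/map_f; rewrite mem_iota.
  + by rewrite nth_default ?eqxx // sq; move: hk p1; case: (size p) => // m; rewrite ltnS.
  + by rewrite hk coefZ -[p`_ _]/(lead_coef p) mulVf ?eqxx ?orbT // lead_coef_eq0.
by exists x; move: rx; rewrite rootZ.
Qed.

(** The substitution z = (p_0 / p_1) y and division by p_0 make both low
    coefficients 1, which leaves those of degrees 2, ..., e and n: e parameters. *)
Lemma root_of_gap_poly d e n (p : {poly E}) : resolvent_closed d -> (0 < e <= d)%N ->
  (e < n)%N -> size p = n.+1 -> p \is monic ->
  (forall i, (e < i < n)%N -> p`_i = 0) -> exists x, root p x.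
Proof.
move=> cl /andP [e0 ed] en sp mp gap.
have pn : p`_n = 1 by move/monicP: mp; rewrite /lead_coef sp.
have [p0|p0] := eqVneq p`_0 0.
  by exists 0; rewrite /root horner_coef0 p0.
have low (F : nat -> E) k : (1 < k <= e)%N -> F k \in [seq F i | i <- iota 2 e.-1].
  by move=> hk; apply: map_f; rewrite mem_iota; lia.
have [p1|p1] := eqVneq p`_1 0.
  apply: (@root_of_few_coefs d (p`_0 :: [seq p`_i | i <- iota 2 e.-1])) => //.
  - by rewrite /= size_map size_iota prednK.
  - by rewrite sp ltnS (leq_ltn_trans _ en).
  move=> [|[|k]]; rewrite ?p1 ?inE ?eqxx ?orbT //.
  have [ke|ke] := leqP k.+2 e; first by rewrite (low (fun i => p`_i)) ?orbT.
  case: (ltngtP k.+2 n) => kn; first by rewrite gap ?ke ?eqxx.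
    by rewrite nth_default ?sp ?eqxx.
  by rewrite kn pn eqxx orbT.
pose t := p`_0 / p`_1; have t0 : t != 0 by rewrite mulf_neq0 ?invr_eq0.
pose G i := p`_i * t ^+ i / p`_0.
pose q := \poly_(i < n.+1) G i.
have [||||y ry] := @root_of_few_coefs d (G n :: [seq G i | i <- iota 2 e.-1]) q => //.
- by rewrite /= size_map size_iota prednK.
- rewrite size_poly_eq ?ltnS ?(leq_ltn_trans _ en) //.
  by rewrite /G pn mul1r mulf_neq0 ?expf_neq0 ?invr_eq0.
- move=> k; rewrite coef_poly; case: ltnP => kn; last by rewrite inE eqxx.
  case: k kn => [|[|k]] kn.
  + by rewrite /G expr0 mulr1 divff // !inE eqxx orbT.
  + by rewrite /G /t expr1 mulrCA divff // mulr1 divff // !inE eqxx orbT.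
  have [ke|ke] := leqP k.+2 e; first by rewrite !inE (low G) ?orbT.
  move: kn; rewrite ltnS leq_eqVlt => /orP [/eqP ->|kn]; first by rewrite !inE eqxx !orbT.
  by rewrite /G gap ?ke // !mul0r inE eqxx.
exists (t * y); move: ry; rewrite /root /q horner_poly (horner_coef p) sp => /eqP h.
have := congr1 (fun x => p`_0 * x) h; rewrite mulr0 mulr_sumr => {}h.
apply/eqP; rewrite -[RHS]h; apply: eq_bigr => i _.
by rewrite /G exprMn; field.
Qed.

End ResolventClosed.

Section Tschirnhaus.
Variable E : fieldType.
Hypothesis char0 : forall m, m.+1%:R != 0 :> E.

(** The entries of X - \sum_j X_j Y_j are homogeneous of degree 1 in X and the X_j
    together, hence so is the determinant, of degree n. *)
Lemma char_poly_generic (n : nat) (Y : 'I_n -> 'M[E]_n) k : (k <= n)%N ->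
  exists T : {mpoly E[n]}, T \is k.-homog /\
    forall b : 'I_n -> E, T.@[b] = (char_poly (\sum_j b j *: Y j))`_(n - k).
Proof.
move=> kn; pose M := \sum_j 'X_j *: map_mx (@mpolyC n E) (Y j).
have Hgr := graded_total_homog E n; have [gr0 grD grN gr1 grM] := Hgr.
exists (char_poly M)`_(n - k); split.
  have H : total_homog n (char_poly M).
    rewrite /char_poly /determinant; apply: graded_sum => // s _.
    apply: (grM 0%N n).
      by have := gradedX s Hgr (grN _ _ gr1); rewrite muln0.
    have {2}<- : (\sum_(i < n) 1 = n)%N by rewrite sum_nat_const card_ord muln1.
    apply: (graded_prod (gr := @total_homog E n)) => // i _; rewrite !mxE; apply: grD.
      by case: eqP => _; rewrite ?mulr1n ?mulr0n //; exact: total_homogX.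
    apply: grN; apply: total_homogC; rewrite summxE; apply: rpred_sum => j _.
    rewrite !mxE mulrC mul_mpolyC; apply: rpredZ.
    by rewrite dhomogX; apply/eqP; exact: mdeg1.
  by have [h _] := H (n - k)%N; have := h (leq_subr _ _); rewrite subKn.
move=> b; rewrite -(coef_map (meval b)) map_char_poly.
suff -> : map_mx (meval b) M = \sum_j b j *: Y j by [].
apply/matrixP => i j; rewrite !mxE !summxE rmorph_sum; apply: eq_bigr => l _ /=.
by rewrite !mxE mevalM mevalXU mevalC.
Qed.

(** Let Z be the companion matrix of f, and let
    p <> 0 of degree below n be such that chi, the characteristic polynomial of
    p(Z), has no terms of degrees n-1, ..., n-l+1. Then chi has a root e. As p - e
    is prime to the irreducible f unless it vanishes, and p(Z) - e is singular,
    p = e. The trace of p(Z) being 0, e = 0: this contradicts p <> 0. *)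
Lemma irreducible_has_root (C : fieldType) (c : {rmorphism C -> E}) d l n (f : {poly E}) :
  resolvent_closed c d -> (2 <= l < n)%N -> (n - l <= d)%N ->
  linear_zeros E (iota 1 l.-1) 1 n ->
  irreducible_poly f -> f \is monic -> size f = n.+1 -> exists x, root f x.
Proof.
case: n => [|n] cl /andP [l2 ln] hd hz irr mf sf; first by move: ln; rewrite ltn0.
have [Z hZ] : exists Z : 'M[E]_n.+1, char_poly Z = f.
  have : exists Z : 'M[E]_((size f).-1), char_poly Z = f.
    by exists (companionmx f); apply: companionmxK.
  by rewrite sf.
have Tk k : exists T : {mpoly E[n.+1]}, (k <= n.+1)%N -> T \is k.-homog /\
    forall b : 'I_n.+1 -> E, T.@[b] = (char_poly (\sum_j b j *: Z ^+ j))`_(n.+1 - k).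
  case: (leqP k n.+1) => kn; last by exists 0.
  by have [T hT] := char_poly_generic (fun j : 'I_n.+1 => Z ^+ j) kn; exists T.
have [T hT] := choice Tk.
have [||A [fA hA]] := hz [seq (k, T k) | k <- iota 1 l.-1].
- by rewrite /unzip1 -map_comp map_id.
- move=> _ /mapP [k kl ->] /=; have [] // := hT k.
  by move: kl; rewrite mem_iota; lia.
pose p := \poly_(j < n.+1) A 0 (inord j).
have p0 : p != 0.
  apply: contraTneq (fA) => ep; rewrite (_ : A = 0) ?/row_free ?mxrank0 //.
  apply/rowP => j; have := congr1 (fun q : {poly E} => q`_j) ep.
  by rewrite coef_poly ltn_ord inord_val coef0 mxE.
have sp : (size p <= n.+1)%N := size_poly _ _.
have pZ : horner_mx Z p = \sum_(j < n.+1) A 0 j *: Z ^+ j.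
  rewrite /p poly_def rmorph_sum; apply: eq_bigr => j _ /=.
  by rewrite linearZ /= rmorphXn /= horner_mx_X inord_val.
pose chi := char_poly (horner_mx Z p).
have schi : size chi = n.+2 by rewrite size_char_poly.
have gap k : (0 < k < l)%N -> chi`_(n.+1 - k) = 0.
  move=> hk; have [|_ hTk] := hT k; first lia.
  rewrite /chi pZ -hTk.
  have := hA (k, T k); rewrite map_f; last by rewrite mem_iota; lia.
  move=> /(_ isT (const_mx 1)) /=; rewrite (_ : _ *m A = A) //.
  by apply/rowP => j; rewrite !mxE big_ord1 mxE mul1r.
have [e re] : exists x, root chi x.
  apply: (@root_of_gap_poly C E c d (n.+1 - l) n.+1) => //; rewrite ?char_poly_monic //; try lia.
  move=> i hi; have := gap (n.+1 - i)%N; rewrite subKn; [apply|]; lia.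
have eZ : p = e%:P.
  apply/eqP; rewrite -subr_eq0; apply: contraTT re => pe0.
  have cop : coprimep f (p - e%:P).
    rewrite irreducible_poly_coprime //; apply/negP => /(dvdp_leq pe0).
    rewrite sf leqNgt ltnS (leq_trans (size_polyD _ _)) // geq_max sp size_polyN.
    by rewrite (leq_trans (size_polyC_leq1 _)).
  rewrite -eigenvalue_root_char -[eigenvalue _ _]/(eigenspace _ _ != 0) negbK.
  rewrite /eigenspace kermx_eq0 row_free_unit.
  have /Bezout_eq1_coprimepP [[u v] /= uv] := cop.
  have : horner_mx Z (u * f + v * (p - e%:P)) = 1 by rewrite uv rmorph1.
  rewrite rmorphD !rmorphM /= -hZ Cayley_Hamilton mulr0 add0r rmorphB /= horner_mx_C.
  by case/mulmx1_unit.
have e0 : e = 0.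
  have := gap 1%N; rewrite subn1 => /(_ l2) /=.
  rewrite -[n in chi`_n]/(n.+1.-1) char_poly_trace // eZ horner_mx_C mxtrace_scalar.
  move/eqP; rewrite oppr_eq0 -mulr_natr mulf_eq0 (negbTE (char0 n)) orbF.
  by move/eqP.
by rewrite eZ e0 eqxx in p0.
Qed.

(** If f is reducible, it has a factor of degree at most n/2 <= n - l, which is
    solvable as it has few coefficients. *)
Lemma degree_has_root (C : fieldType) (c : {rmorphism C -> E}) d l n (f : {poly E}) :
  resolvent_closed c d -> (2 <= l)%N -> (2 * l <= n)%N -> (n - l <= d)%N ->
  linear_zeros E (iota 1 l.-1) 1 n -> size f = n.+1 -> exists x, root f x.
Proof.
move=> cl l2 ln hd hz sf.
have f0 : f != 0 by rewrite -size_poly_gt0 sf.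
wlog mf : f f0 sf / f \is monic => [H|].
  have l0 : (lead_coef f)^-1 != 0 by rewrite invr_eq0 lead_coef_eq0.
  have [|||x] := H ((lead_coef f)^-1 *: f); last by rewrite rootZ //; exists x.
  - by rewrite scaler_eq0 negb_or l0.
  - by rewrite size_scale.
  - by rewrite monicE lead_coefZ mulVf // lead_coef_eq0.
have [irr|nirr] := pselect (irreducible_poly f).
  by apply: (irreducible_has_root cl _ hd hz irr mf sf); lia.
have [q [sq qf nqf]] : exists q : {poly E}, [/\ size q != 1%N, q %| f & ~~ (q %= f)].
  apply: contrapT => nex; apply: nirr; split; first by rewrite sf; lia.
  move=> q sq qf; apply: contraT => nqf; case: nex; by exists q.
have [u fu] : exists u, f = u * q by apply/dvdpP.
have q0 : q != 0 by apply: contraNneq f0 => q0; rewrite fu q0 mulr0.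
have u0 : u != 0 by apply: contraNneq f0 => u0; rewrite fu u0 mul0r.
have su : (0 < size u)%N by rewrite size_poly_gt0.
have sq0 : (0 < size q)%N by rewrite size_poly_gt0.
have suq : (size u + size q = n.+2)%N.
  by have := size_mul u0 q0; rewrite -fu sf; move: (size u) (size q) su => m m'; lia.
have sqf : (size q < n.+1)%N.
  by rewrite ltn_neqAle -{2}sf dvdp_leq // andbT -sf (dvdp_size_eqp qf).
have q1 : (1 < size q)%N by move: sq sq0; case: (size q) => [|[]].
have hroots := resolvent_closed_has_roots cl.
have [uq|qu] := leqP (size u) (size q).
  have [|x rx] := hroots u; first by move: (size u) (size q) suq sqf uq => m m'; lia.
  by exists x; rewrite fu rootM rx.
have [|x rx] := hroots q; first by move: (size u) (size q) suq qu q1 => m m'; lia.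
by exists x; rewrite fu rootM rx orbT.
Qed.

End Tschirnhaus.

(** * The degrees that can be solved *)

Section DegreeBounds.
Variable C : fieldType.

Definition degree_solvable (l n : nat) : Prop :=
  forall (E : fieldType) (c : {rmorphism C -> E}) d (f : {poly E}),
    (forall m, m.+1%:R != 0 :> E) -> resolvent_closed c d -> (n - l <= d)%N ->
    size f = n.+1 -> exists x, root f x.

Lemma quartic_room_leq k a b e N N' : (N <= N')%N ->
  quartic_room k a b e N -> quartic_room k a b e N'.
Proof.
elim: k a b e N N' => [|k IH] a b e N N' NN' /= /andP [h r]; rewrite (leq_trans h) ?leq_mul2l //=.
by apply: IH r; lia.
Qed.

Lemma degree_solvable7 n : (109 <= n)%N -> degree_solvable 7 n.
Proof.
move=> hn E c d f char0 cl hd; apply: (degree_has_root char0 cl _ _ hd) => //; first by lia.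
(* 102 = 109 - 7 <= d *)
have H : has_roots E 102.
  move=> p /andP [p1 p2]; apply: (resolvent_closed_has_roots cl); rewrite p1; lia.
by apply: (tschirnhaus_room H) => //; apply: quartic_room_leq hn _; vm_compute.
Qed.

Lemma degree_solvable8 n : (325 <= n)%N -> degree_solvable 8 n.
Proof.
move=> hn E c d f char0 cl hd; apply: (degree_has_root char0 cl _ _ hd) => //; first by lia.
(* 317 = 325 - 8 <= d *)
have H : has_roots E 317.
  move=> p /andP [p1 p2]; apply: (resolvent_closed_has_roots cl); rewrite p1; lia.
by apply: (tschirnhaus_room H) => //; apply: quartic_room_leq hn _; vm_compute.
Qed.

Lemma fact_eq24 l : (5 <= l)%N -> exists2 K, (l.-1)`! = (24 * K)%N & (0 < K)%N.
Proof.
move=> hl; have h : (4 <= l.-1)%N by lia.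
exists ('C(l.-1, 4) * (l.-1 - 4)`!)%N; first by rewrite -(bin_fact h) mulnCA mulnA mulnAC.
by rewrite muln_gt0 bin_gt0 h fact_gt0.
Qed.

Lemma fact_ge_pow3 j : (24 * 3 ^ (5 + j) <= (8 + j)`!)%N.
Proof.
elim: j => [|j IH]; first by rewrite !factS fact0 !expnS expn0; lia.
by rewrite !addnS expnS factS mulnCA; apply: leq_mul; lia.
Qed.

Lemma room_9_14 l n : (9 <= l <= 14)%N -> ((l.-1)`! < 24 * n)%N ->
  quartic_room (l - 5) 1 1 1 n.
Proof.
(* 1681 = 8!/24 + 1; for l >= 10 the value 4000 < 9!/24 leaves room up to l = 14 *)
move=> hl hn; have [l9|l10] := leqP l 9.
  have -> : l = 9 by lia.
  apply: (@quartic_room_leq _ _ _ _ 1681); last by vm_compute.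
  have e : l = 9 by lia.
  by move: hn; rewrite e /= !factS fact0; lia.
apply: (@quartic_room_leq _ _ _ _ 4000).
  have : (9`! <= (l.-1)`!)%N by apply: leq_fact; lia.
  by move: hn; rewrite !factS fact0; lia.
have : l \in iota 10 5 by rewrite mem_iota; lia.
move: l {hl hn l10}; apply/allP; by vm_compute.
Qed.

(** The previous value of l serves for the degrees above n - l and at most
    (l-1)!/24; these are less than n, so n - l parameters suffice for them. *)
Lemma degree_solvable_step l n : (9 <= l <= 14)%N -> ((l.-1)`! < 24 * n)%N ->
  (forall m, (325 <= m)%N -> ((l.-2)`! < 24 * m)%N -> degree_solvable l.-1 m) ->
  degree_solvable l n.
Proof.
move=> hl hn IH E c d f char0 cl hd.
have [|K eK K0] := @fact_eq24 l; first by lia.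
have h8 : (24 * 1680 <= (l.-1)`!)%N.
  by apply: leq_trans (_ : 8`! <= _)%N; [rewrite !factS fact0; lia | apply: leq_fact; lia].
have nK : (K < n)%N by rewrite eK ltn_pmul2l in hn.
apply: (degree_has_root char0 cl _ _ hd) => //; [lia|lia|].
have H : has_roots E K.
  move=> p /andP [p1 p2].
  have [pd|pd] := leqP (size p) d.+1.
    by apply: (resolvent_closed_has_roots cl); rewrite p1.
  have [m em] : exists m, size p = m.+1 by move: p1; case: (size p) => // m _; exists m.
  rewrite em !ltnS in pd p2.
  apply: (IH m _ _ E c d) => //; [lia| |lia].
  have eF : ((l.-1)`! = l.-1 * (l.-2)`!)%N.
    by have -> : l.-1 = l.-2.+1 by lia.
  have hF : (24 * 210 <= (l.-2)`!)%N.
    by apply: leq_trans (_ : 7`! <= _)%N; [rewrite !factS fact0; lia | apply: leq_fact; lia].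
  move: ((l.-2)`!)%N eF hF => F eF hF.
  have : (8 * F <= l.-1 * F)%N by rewrite leq_mul2r; apply/orP; right; lia.
  lia.
apply: (tschirnhaus_room H); [lia | lia | by rewrite eK | | exact: room_9_14].
rewrite -(leq_pmul2l (isT : (0 < 24)%N)) -eK.
have := fact_ge_pow3 (l - 9); rewrite (_ : (5 + (l - 9) = l - 4)%N) 1?(_ : (8 + (l - 9) = l.-1)%N) //; lia.
Qed.

Lemma degree_solvable_9_14 l n : (9 <= l <= 14)%N -> ((l.-1)`! < 24 * n)%N ->
  degree_solvable l n.
Proof.
elim: l n => [|l IH] n hl hn; first by lia.
apply: degree_solvable_step => // m m325 hm.
have [l9|l9] := leqP 9 l; first by apply: IH => //; lia.
have -> : l.+1.-1 = 8 by lia.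
exact: degree_solvable8.
Qed.

End DegreeBounds.

(** * Subfields and algebraic dependence *)

Section PropSubfield.
Variables (F : fieldType) (S : F -> Prop).

Definition field_closed : Prop :=
  [/\ S 1, forall x y, S x -> S y -> S (x - y) & forall x y, S x -> S y -> S (x / y)].

Hypothesis S_closed : field_closed.

(** The proof is an argument so that the closure properties can be attached to
    the predicate as canonical instances. *)
Definition closed_pred of field_closed : {pred F} := fun x => asbool (S x).

Lemma closed_predP h x : reflect (S x) (x \in closed_pred h).
Proof. exact: asboolP. Qed.

Lemma closed_pred_divring h : divring_closed (closed_pred h).
Proof.
case: (h) => S1 SB Sd; split; first exact/closed_predP.
  by move=> x y /closed_predP Sx /closed_predP Sy; apply/closed_predP/SB.
by move=> x y /closed_predP Sx /closed_predP Sy; apply/closed_predP/Sd.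
Qed.

HB.instance Definition _ h :=
  GRing.isDivringClosed.Build F (closed_pred h) (closed_pred_divring h).

Record subfield_of (h : field_closed) := Subfield { sfval : F; _ : sfval \in closed_pred h }.

HB.instance Definition _ h := [isSub for @sfval h].
HB.instance Definition _ h := [Choice of subfield_of h by <:].
HB.instance Definition _ h := [SubChoice_isSubUnitRing of subfield_of h by <:].
HB.instance Definition _ h := [SubNzRing_isSubComNzRing of subfield_of h by <:].
HB.instance Definition _ h := [SubComUnitRing_isSubIntegralDomain of subfield_of h by <:].
HB.instance Definition _ h := [SubIntegralDomain_isSubField of subfield_of h by <:].

Lemma sfvalP h (x : subfield_of h) : S (sfval x).
Proof. by case: x => y /= /closed_predP. Qed.

Definition in_subfield h x (Sx : S x) : subfield_of h := Subfield (introT (closed_predP h x) Sx).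

End PropSubfield.

Section FieldClosed.
Variables (F : fieldType) (S : F -> Prop).
Hypothesis S_closed : field_closed S.

Lemma field_closedB x y : S x -> S y -> S (x - y). Proof. by case: S_closed => _ + _; apply. Qed.
Lemma field_closed_div x y : S x -> S y -> S (x / y). Proof. by case: S_closed => _ _; apply. Qed.
Lemma field_closed1 : S 1. Proof. by case: S_closed. Qed.
Lemma field_closed0 : S 0. Proof. by rewrite -(subrr 1); apply: field_closedB; exact: field_closed1. Qed.
Lemma field_closedN x : S x -> S (- x).
Proof. by rewrite -sub0r; apply: field_closedB; exact: field_closed0. Qed.
Lemma field_closedD x y : S x -> S y -> S (x + y).
Proof. by move=> Sx Sy; rewrite -[y]opprK; apply: field_closedB => //; exact: field_closedN. Qed.
Lemma field_closedV x : S x -> S x^-1.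
Proof. by rewrite -div1r; apply: field_closed_div; exact: field_closed1. Qed.
Lemma field_closedM x y : S x -> S y -> S (x * y).
Proof. by move=> Sx Sy; rewrite -[y]invrK; apply: field_closed_div => //; exact: field_closedV. Qed.
Lemma field_closedX x k : S x -> S (x ^+ k).
Proof. by move=> Sx; elim: k => [|k IH]; rewrite ?exprS; [exact: field_closed1 | exact: field_closedM]. Qed.
Lemma field_closed_sum (I : Type) (r : seq I) (P : pred I) (G : I -> F) :
  (forall i, P i -> S (G i)) -> S (\sum_(i <- r | P i) G i).
Proof. by move=> H; elim/big_ind: _ => //; [exact: field_closed0 | exact: field_closedD]. Qed.
Lemma field_closed_prod (I : Type) (r : seq I) (P : pred I) (G : I -> F) :
  (forall i, P i -> S (G i)) -> S (\prod_(i <- r | P i) G i).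
Proof. by move=> H; elim/big_ind: _ => //; [exact: field_closed1 | exact: field_closedM]. Qed.

Lemma field_closed_mmap (C : fieldType) (c : {rmorphism C -> F}) m (b : 'I_m -> F) p :
  (forall z, S (c z)) -> (forall i, S (b i)) -> S (mmap c b p).
Proof.
move=> Sc Sb; apply: field_closed_sum => a _; apply: field_closedM => //.
by apply: field_closed_prod => i _; apply: field_closedX.
Qed.

Lemma field_closed_poly (p : {poly F}) : (forall k, S p`_k) ->
  exists q : {poly subfield_of S_closed}, map_poly val q = p.
Proof.
move=> Sp; exists (\poly_(i < size p) in_subfield S_closed (Sp i)).
by apply/polyP => i; rewrite coef_map coef_poly /=; case: ltnP => // /(nth_default 0) ->.
Qed.

End FieldClosed.

Lemma mmap_muni (C F : comNzRingType) (c : {rmorphism C -> F}) m (b : 'I_m.+1 -> F)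
    (p : {mpoly C[m.+1]}) :
  (map_poly (mmap c (fun i => b (widen_ord (leqnSn m) i))) (muni p)).[b ord_max] = mmap c b p.
Proof.
pose phi : {rmorphism {poly {mpoly C[m]}} -> F} :=
  horner_eval (b ord_max) \o map_poly (mmap c (fun i => b (widen_ord (leqnSn m) i))).
apply: (etrans (rmorph_mmap phi _ _ _)); apply: eq_mmap => [z|i] /=.
  by rewrite /horner_eval map_polyC hornerC /= mmapC.
rewrite /horner_eval; case: splitP => [j ij|j ij].
  by rewrite map_polyC hornerC /= mmapX mmap1U; congr b; apply: val_inj.
by rewrite map_polyX hornerX; congr b; apply: val_inj; move: ij => /= ->; rewrite (ord1 j) addn0.
Qed.

Lemma muni_neq0 (C : comNzRingType) m (p : {mpoly C[m.+1]}) : p != 0 -> muni p != 0.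
Proof.
apply: contraNneq => p0.
have <- : mmap (@mpolyC m.+1 C) (fun i => 'X_i) p = p.
  by rewrite [RHS]mpolyE; apply: eq_bigr => a _; rewrite mmap1_id mul_mpolyC.
by rewrite -mmap_muni p0 rmorph0 horner0.
Qed.

Section Adjoin.
Variables (C F : fieldType) (c : {rmorphism C -> F}).

Lemma in_adjoin_closed m (b : 'I_m -> F) : field_closed (in_adjoin c b).
Proof.
split.
- by exists 1, 1; rewrite !rmorph1 divr1 oner_neq0.
- move=> _ _ [p [q [q0 ->]]] [p' [q' [q'0 ->]]].
  exists (p * q' - p' * q), (q * q'); rewrite !(rmorphM, rmorphB) /= mulf_neq0 //.
  by split=> //; field; rewrite ?q0 ?q'0.
- move=> _ _ [p [q [q0 ->]]] [p' [q' [q'0 ->]]].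
  have [p'0|p'0] := eqVneq (mmap c b p') 0.
    by exists 0, 1; rewrite rmorph1 rmorph0 oner_neq0 p'0 !mul0r invr0 mulr0.
  exists (p * q'), (q * p'); rewrite !rmorphM /= mulf_neq0 //.
  by split=> //; field; rewrite ?q0 ?q'0 ?p'0.
Qed.

Lemma in_adjoin_min m (b : 'I_m -> F) (S : F -> Prop) y : field_closed S ->
  (forall z, S (c z)) -> (forall i, S (b i)) -> in_adjoin c b y -> S y.
Proof. by move=> Sf Sc Sb [p [q [_ ->]]]; apply: field_closed_div => //; exact: field_closed_mmap. Qed.

Lemma algebraic_overP m (b : 'I_m -> F) x :
  algebraic_over c b x <-> integralOver (val : subfield_of (in_adjoin_closed b) -> F) x.
Proof.
split=> [[P [P0 Pb Px]]|/integral_algebraic [p p0 px]]; last first.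
  exists (map_poly val p); split=> //; first by rewrite map_poly_eq0.
  by move=> k; rewrite coef_map; exact: sfvalP.
have [Q eQ] := field_closed_poly (in_adjoin_closed b) Pb.
apply/integral_algebraic; exists Q; last by rewrite eQ.
by apply: contraNneq P0 => Q0; rewrite -eQ Q0 rmorph0.
Qed.

Lemma algebraic_over_adjoin m (b : 'I_m -> F) x : in_adjoin c b x -> algebraic_over c b x.
Proof.
move=> bx; apply/algebraic_overP.
exact: (integral_id (val : {rmorphism subfield_of (in_adjoin_closed b) -> F}) (in_subfield _ bx)).
Qed.

Lemma algebraic_over_closed m (b : 'I_m -> F) : field_closed (algebraic_over c b).
Proof.
split; first by apply: algebraic_over_adjoin; exact: field_closed1 (in_adjoin_closed b).
- by move=> x y /algebraic_overP Hx /algebraic_overP Hy; apply/algebraic_overP/integral_sub.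
- by move=> x y /algebraic_overP Hx /algebraic_overP Hy; apply/algebraic_overP/integral_div.
Qed.

Lemma algebraic_over_root m (b : 'I_m -> F) (p : {poly F}) x : p != 0 -> root p x ->
  (forall k, algebraic_over c b p`_k) -> algebraic_over c b x.
Proof.
move=> p0 px hp; apply/algebraic_overP; apply: integral_root p0 px _.
by move=> _ /(nthP 0) [k _ <-]; apply/algebraic_overP.
Qed.

Lemma algebraic_over_trans m n (b : 'I_m -> F) (b' : 'I_n -> F) x :
  (forall i, algebraic_over c b' (b i)) -> algebraic_over c b x -> algebraic_over c b' x.
Proof.
move=> hb [P [P0 Pb Px]]; apply: algebraic_over_root P0 Px _ => k.
apply: in_adjoin_min (Pb k) => //; first exact: algebraic_over_closed.
by move=> z; apply: algebraic_over_adjoin; exact: in_adjoin_const.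
Qed.

Lemma algebraic_over_widen m n (b : 'I_m -> F) (b' : 'I_n -> F) x :
  (forall i, exists j, b i = b' j) -> algebraic_over c b x -> algebraic_over c b' x.
Proof.
move=> hb; apply: algebraic_over_trans => i; have [j ->] := hb i.
by apply: algebraic_over_adjoin; exact: in_adjoin_var.
Qed.

(** In a relation, seen as a polynomial in the last variable, either the
    coefficients do not all vanish at the other elements, and the last element is
    algebraic over these, or they give a relation among the other elements. *)
Lemma dependent_shorten m (b : 'I_m -> F) : ~ alg_indep c b ->
  exists m', m = m'.+1 /\ exists b' : 'I_m' -> F, forall i, algebraic_over c b' (b i).
Proof.
elim: m b => [|m IH] b dep.
  case: dep => p; have [z ->] : exists z, p = z%:MP by exists p@_0%MM; exact: nvar0_mpolyC.
  by rewrite mmapC => /eqP; rewrite fmorph_eq0 => /eqP ->.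
exists m; split=> //.
have [p [p0 bp]] : exists p : {mpoly C[m.+1]}, p != 0 /\ mmap c b p = 0.
  apply: contrapT => nex; apply: dep => p bp; apply/eqP; apply: contraT => p0.
  by case: nex; exists p.
pose b0 i := b (widen_ord (leqnSn m) i).
have q0 := muni_neq0 p0.
have hb i : (exists j, b i = b0 j) \/ i = ord_max.
  case: (unliftP ord_max i) => [j ->|->]; [left|by right].
  by exists j; congr b; apply: val_inj; rewrite /= /bump leqNgt ltn_ord.
have [Q0|Q0] := eqVneq (map_poly (mmap c b0) (muni p)) 0; last first.
  exists b0 => i; case: (hb i) => [[j ->]|->].
    by apply: algebraic_over_adjoin; exact: in_adjoin_var.
  exists (map_poly (mmap c b0) (muni p)); split=> //.
    by move=> k; rewrite coef_map; apply: field_closed_mmap => [|z|j];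
      [exact: in_adjoin_closed | exact: in_adjoin_const | exact: in_adjoin_var].
  by rewrite /root mmap_muni bp.
have [|m' [em [b' hb']]] := IH b0.
  move=> ind; case/eqP: q0; apply/polyP => k; rewrite coef0; apply: ind.
  by rewrite -(coef_map (mmap c b0)) Q0 coef0.
subst m; exists (fun i => if unlift ord_max i is Some j then b' j else b ord_max) => i.
case: (hb i) => [[j ->]|->].
  apply: algebraic_over_widen (hb' j) => l; exists (lift ord_max l); by rewrite liftK.
apply: algebraic_over_adjoin.
have := in_adjoin_var c (fun i => if unlift ord_max i is Some j then b' j else b ord_max) ord_max.
by rewrite unlift_none.
Qed.

Lemma trdeg_le_of_algebraic d (b : 'I_d -> F) :
  (forall x, algebraic_over c b x) -> trdeg_le c d.
Proof.
elim: d b => [|d IH] b hb.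
all: have [ind|dep] := pselect (alg_indep c b); first by eexists; exists b; split=> //; split.
all: have [m' [em [b' hb']]] := dependent_shorten dep; case: em => // em.
have [|m'' [b'' [le tb]]] := IH (fun i => b' (cast_ord em i)).
  move=> x; apply: algebraic_over_trans (hb x) => i; apply: algebraic_over_widen (hb' i) => j.
  by exists (cast_ord (esym em) j); rewrite cast_ordKV.
by exists m'', b''; split=> //; apply: leqW.
Qed.

End Adjoin.

Section AdjoinMorph.
Variables (C F G : fieldType) (c : {rmorphism C -> F}) (c' : {rmorphism C -> G}).
Variables (h : {rmorphism F -> G}).
Hypothesis hc : forall z, h (c z) = c' z.

Lemma rmorph_mmap_comp m (b : 'I_m -> F) p : h (mmap c b p) = mmap c' (h \o b) p.
Proof. by rewrite rmorph_mmap; apply: eq_mmap => // z; exact: hc. Qed.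

Lemma in_adjoin_morph m (b : 'I_m -> F) y :
  in_adjoin c' (h \o b) y <-> exists2 x, in_adjoin c b x & y = h x.
Proof.
split=> [[p [q [q0 ->]]]|[_ [p [q [q0 ->]]] ->]].
  exists (mmap c b p / mmap c b q); last by rewrite fmorph_div !rmorph_mmap_comp.
  by exists p, q; split=> //; rewrite -(fmorph_eq0 h) rmorph_mmap_comp.
by exists p, q; rewrite -!rmorph_mmap_comp fmorph_eq0 fmorph_div.
Qed.

(** Being algebraic over C(b) does not depend on the field that contains b. *)
Lemma algebraic_over_morph m (b : 'I_m -> F) x :
  algebraic_over c' (h \o b) (h x) <-> algebraic_over c b x.
Proof.
split=> [[P [P0 Pb Px]]|[P [P0 Pb Px]]]; last first.
  exists (map_poly h P); split; rewrite ?map_poly_eq0 ?fmorph_root //.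
  by move=> k; rewrite coef_map; apply/in_adjoin_morph; exists P`_k.
have [f hf] : exists f : nat -> F, forall k, in_adjoin c b (f k) /\ P`_k = h (f k).
  have H k : exists y, in_adjoin c b y /\ P`_k = h y.
    by have /in_adjoin_morph [y hy e] := Pb k; exists y.
  by have [f hf] := choice H; exists f.
have eP : map_poly h (\poly_(k < size P) f k) = P.
  apply/polyP => k; rewrite coef_map coef_poly; case: ltnP => hk; first by case: (hf k).
  by rewrite [RHS]nth_default //; exact: rmorph0.
exists (\poly_(k < size P) f k); split.
- by apply: contraNneq P0 => P0; rewrite -eP P0 rmorph0.
- move=> k; rewrite coef_poly; case: ifP => _; first by case: (hf k).
  exact: field_closed0 (in_adjoin_closed c b).
- by rewrite -eP fmorph_root in Px.
Qed.

End AdjoinMorph.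

(** * An algebraically closed extension of the field of rational functions *)

Section Ultrapower.
Local Open Scope quotient_scope.
Variables (T : Type) (C : fieldType) (U : (T -> Prop) -> Prop).

Definition ultra : Prop :=
  [/\ U (fun _ => True), forall P Q : T -> Prop, (forall t, P t -> Q t) -> U P -> U Q,
      forall P Q : T -> Prop, U P -> U Q -> U (fun t => P t /\ Q t),
      ~ U (fun _ => False) & forall P : T -> Prop, U P \/ U (fun t => ~ P t)].

Hypothesis U_ultra : ultra.

Let UT : U (fun _ => True). Proof. by case: U_ultra. Qed.
Let US (P Q : T -> Prop) : (forall t, P t -> Q t) -> U P -> U Q.
Proof. by case: U_ultra => _ + _ _ _; apply. Qed.
Let UI (P Q : T -> Prop) : U P -> U Q -> U (fun t => P t /\ Q t).
Proof. by case: U_ultra => _ _ + _ _; apply. Qed.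
Let UF : ~ U (fun _ => False). Proof. by case: U_ultra. Qed.
Let UN (P : T -> Prop) : U P \/ U (fun t => ~ P t). Proof. by case: U_ultra. Qed.

Local Notation family := (classicType (T -> C)).

Definition ultra_eq : rel family :=
  fun f g => asbool (U (fun t => (f : T -> C) t = (g : T -> C) t)).

Lemma ultra_eq_equiv : equiv_class_of ultra_eq.
Proof.
split.
- by move=> f; apply/asboolP; apply: US UT.
- by move=> f g; apply/asboolP/asboolP; apply: US.
- move=> g f h /asboolP fg /asboolP gh; apply/asboolP.
  by apply: US (UI fg gh) => t [-> ->].
Qed.

Canonical ultra_equiv := EquivRelPack ultra_eq_equiv.

Definition ultrapower := {eq_quot ultra_eq}.
HB.instance Definition _ := Choice.on ultrapower.
HB.instance Definition _ := EqQuotient.on ultrapower.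

Definition ultra_class (f : T -> C) : ultrapower := \pi_(ultrapower) (f : family).

Lemma ultra_classP f g : reflect (U (fun t => f t = g t)) (ultra_class f == ultra_class g).
Proof. by rewrite /ultra_class; apply: (iffP eqP) => [/eqmodP/asboolP|H]; last exact/eqmodP/asboolP. Qed.

Lemma ultra_class_eq f g : U (fun t => f t = g t) -> ultra_class f = ultra_class g.
Proof. by move/ultra_classP/eqP. Qed.

Lemma ultra_repr (x : ultrapower) : exists f, x = ultra_class f.
Proof. by exists (repr x); rewrite /ultra_class reprK. Qed.

Definition ultra_op1 (op : C -> C) (x : ultrapower) : ultrapower :=
  ultra_class (fun t => op (repr x t)).
Definition ultra_op2 (op : C -> C -> C) (x y : ultrapower) : ultrapower :=
  ultra_class (fun t => op (repr x t) (repr y t)).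

Lemma ultra_reprE f : U (fun t => repr (ultra_class f) t = f t).
Proof. by apply/ultra_classP; rewrite /ultra_class reprK. Qed.

Lemma ultra_op1E op f : ultra_op1 op (ultra_class f) = ultra_class (fun t => op (f t)).
Proof. by apply: ultra_class_eq; apply: US (ultra_reprE f) => t ->. Qed.

Lemma ultra_op2E op f g :
  ultra_op2 op (ultra_class f) (ultra_class g) = ultra_class (fun t => op (f t) (g t)).
Proof. by apply: ultra_class_eq; apply: US (UI (ultra_reprE f) (ultra_reprE g)) => t [-> ->]. Qed.

Let add := ultra_op2 +%R.
Let mul := ultra_op2 *%R.
Let opp := ultra_op1 -%R.
Let inv := ultra_op1 GRing.inv.
Let cst z : ultrapower := ultra_class (fun _ => z).

Ltac ultra_ring :=
  repeat (let x := fresh "x" in move=> x; have [? ->] := ultra_repr x => {x});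
  rewrite /add /mul /opp /cst ?(ultra_op2E, ultra_op1E);
  apply: ultra_class_eq; apply: US UT => t _; ring.

Let addA : associative add. Proof. by ultra_ring. Qed.
Let addC : commutative add. Proof. by ultra_ring. Qed.
Let add0 : left_id (cst 0) add. Proof. by ultra_ring. Qed.
Let addN : left_inverse (cst 0) opp add. Proof. by ultra_ring. Qed.
Let mulA : associative mul. Proof. by ultra_ring. Qed.
Let mulC : commutative mul. Proof. by ultra_ring. Qed.
Let mul1 : left_id (cst 1) mul. Proof. by ultra_ring. Qed.
Let mulDl : left_distributive mul add. Proof. by ultra_ring. Qed.
Let one_neq0 : cst 1 != cst 0.
Proof. by apply/negP => /ultra_classP H; apply: UF; apply: US H => t /eqP; rewrite oner_eq0. Qed.

HB.instance Definition _ := GRing.isZmodule.Build ultrapower addA addC add0 addN.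
HB.instance Definition _ :=
  GRing.Zmodule_isComNzRing.Build ultrapower mulA mulC mul1 mulDl one_neq0.

Let mulV (x : ultrapower) : x != 0 -> mul (inv x) x = 1.
Proof.
have [f ->] := ultra_repr x => {x} f0; rewrite /mul /inv ultra_op1E ultra_op2E.
apply: ultra_class_eq; case: (UN (fun t => f t = 0)) => [Uf|].
  by case/eqP: f0; apply: ultra_class_eq.
by apply: US => t /eqP; exact: mulVf.
Qed.

Let inv0 : inv 0 = 0.
Proof. by rewrite /inv ultra_op1E invr0. Qed.

HB.instance Definition _ := GRing.ComNzRing_isField.Build ultrapower mulV inv0.

Lemma ultra_classD f g : ultra_class f + ultra_class g = ultra_class (fun t => f t + g t).
Proof. exact: ultra_op2E. Qed.
Lemma ultra_classM f g : ultra_class f * ultra_class g = ultra_class (fun t => f t * g t).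
Proof. exact: ultra_op2E. Qed.
Lemma ultra_classB f g : ultra_class f - ultra_class g = ultra_class (fun t => f t - g t).
Proof. by rewrite -[- _]/(ultra_op1 _ _) ultra_op1E ultra_classD. Qed.
Lemma ultra_classX f k : ultra_class f ^+ k = ultra_class (fun t => f t ^+ k).
Proof.
elim: k => [|k IH]; first by rewrite expr0; apply: ultra_class_eq; apply: US UT.
by rewrite exprS IH ultra_classM; apply: ultra_class_eq; apply: US UT => t _; rewrite exprS.
Qed.
Lemma ultra_class_sum k (f : nat -> T -> C) :
  \sum_(i < k) ultra_class (f i) = ultra_class (fun t => \sum_(i < k) f i t).
Proof.
elim: k => [|k IH]; first by rewrite big_ord0; apply: ultra_class_eq; apply: US UT => t _; rewrite big_ord0.
rewrite big_ord_recr /= IH ultra_classD; apply: ultra_class_eq; apply: US UT => t _.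
by rewrite big_ord_recr.
Qed.

(** The polynomial is solved in almost every coordinate, namely wherever its
    leading coefficient does not vanish. *)
Lemma ultrapower_root :
  (forall p : {poly C}, (1 < size p)%N -> exists x, root p x) ->
  forall p : {poly ultrapower}, (1 < size p)%N -> exists x, root p x.
Proof.
move=> rootC p sp; have [f hf] := choice (fun k => ultra_repr p`_k).
pose q t := \poly_(k < size p) f k t.
have [g hg] : exists g : T -> C, forall t, (1 < size (q t))%N -> root (q t) (g t).
  have H t : exists y, (1 < size (q t))%N -> root (q t) y.
    case: (boolP (1 < size (q t))%N) => h; last by exists 0.
    by have [y ry] := rootC _ h; exists y.
  by have [g hg] := choice H; exists g.
exists (ultra_class g); apply/eqP; rewrite horner_coef.
under eq_bigr do rewrite hf ultra_classX ultra_classM.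
rewrite (ultra_class_sum _ (fun k t => f k t * g t ^+ k)).
apply: ultra_class_eq.
have lead : U (fun t => f (size p).-1 t <> 0).
  case: (UN (fun t => f (size p).-1 t = 0)) => // H.
  have : lead_coef p == 0 by rewrite /lead_coef hf; apply/eqP/ultra_class_eq.
  by rewrite lead_coef_eq0 -size_poly_eq0 -leqn0 leqNgt (ltnW sp).
apply: US lead => t /eqP ft.
have sq : size (q t) = size p by rewrite size_poly_eq.
have := hg t; rewrite sq => /(_ sp) /eqP; rewrite horner_coef sq => e.
rewrite -[RHS]e; apply: eq_bigr => i _; by rewrite coef_poly ltn_ord.
Qed.

End Ultrapower.

Section RmorphismOf.
Variables (A B : nzRingType) (f : A -> B).
Hypotheses (fB : forall x y, f (x - y) = f x - f y) (fM : forall x y, f (x * y) = f x * f y).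
Hypothesis f1 : f 1 = 1.

Lemma rmorphism_of : exists g : {rmorphism A -> B}, forall x, g x = f x.
Proof.
pose add := GRing.isZmodMorphism.Build A B f fB.
pose mul := GRing.isMonoidMorphism.Build A B f (f1, fM).
pose g : {rmorphism A -> B} := HB.pack f add mul.
by exists g.
Qed.

End RmorphismOf.

Lemma fraction_extend (A : idomainType) (L : fieldType) (phi : {rmorphism A -> L}) :
  injective phi ->
  exists psi : {rmorphism {fraction A} -> L}, forall a, psi (FracField.tofrac a) = phi a.
Proof.
move=> phi_inj.
have phi0 v : v != 0 -> phi v != 0 by rewrite -(rmorph0 phi) (inj_eq phi_inj).
have H (x : {fraction A}) : exists w : A * A,
    w.2 != 0 /\ FracField.tofrac w.2 * x = FracField.tofrac w.1.
  by have [u [v [v0 e]]] := fraction_numden x; exists (u, v).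
have [w hw] := choice H.
pose f x := phi (w x).1 / phi (w x).2.
have fE x u v : v != 0 -> FracField.tofrac v * x = FracField.tofrac u -> f x = phi u / phi v.
  move=> v0 e; have [w0 ew] := hw x.
  apply/eqP; rewrite eqr_div ?phi0 // -!rmorphM; apply/eqP; congr (phi _).
  apply/eqP; rewrite -tofrac_eq !tofracM -ew -e; apply/eqP; ring.
have [||| psi hpsi] := @rmorphism_of {fraction A} L f.
- move=> x y; have [x0 ex] := hw x; have [y0 ey] := hw y.
  rewrite (@fE _ ((w x).1 * (w y).2 - (w y).1 * (w x).2) ((w x).2 * (w y).2)).
  + rewrite /f !(rmorphB, rmorphM) /=; field; by rewrite !phi0.
  + exact: mulf_neq0.
  + by rewrite tofracB !tofracM -ex -ey; ring.
- move=> x y; have [x0 ex] := hw x; have [y0 ey] := hw y.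
  rewrite (@fE _ ((w x).1 * (w y).1) ((w x).2 * (w y).2)).
  + rewrite /f !rmorphM /=; field; by rewrite !phi0.
  + exact: mulf_neq0.
  + by rewrite !tofracM -ex -ey; ring.
- by rewrite (@fE _ 1 1) ?oner_neq0 // ?rmorph1 ?divr1 // mulr1.
by exists psi => a; rewrite hpsi (@fE _ a 1) ?rmorph1 ?divr1 ?oner_neq0 ?mul1r.
Qed.

Lemma mpoly_nonzero_point (C : fieldType) n (p : {mpoly C[n]}) :
  (forall m, m.+1%:R != 0 :> C) -> p != 0 -> exists v : 'I_n -> C, p.@[v] != 0.
Proof.
move=> char0; elim: n p => [|n IH] p p0.
  exists (fun=> 0); move: p0; rewrite (nvar0_mpolyC p) mevalC.
  by apply: contraNneq => ->; rewrite mpolyC0.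
have q0 := muni_neq0 p0.
have [k qk] : exists k, (muni p)`_k != 0.
  by exists (size (muni p)).-1; rewrite -[_`__]/(lead_coef _) lead_coef_eq0.
have [v vk] := IH _ qk.
pose q := map_poly (meval v) (muni p).
have qn0 : q != 0 by apply: contraNneq vk => q0'; rewrite -(coef_map (meval v)) -/q q0' coef0.
have [x qx] : exists x, ~~ root q x.
  apply: contrapT => nex.
  have : (size [seq i%:R : C | i <- iota 0 (size q)] < size q)%N.
    apply: max_poly_roots => //.
      by apply/allP => _ /mapP [i _ ->]; apply: contraT => h; case: nex; eexists; exact: h.
    rewrite map_inj_uniq ?iota_uniq // => i j.
    wlog ij : i j / (i <= j)%N => [W|] e.
      by case: (leqP i j) => [/W|/ltnW/W]; [exact | move=> W'; apply/esym/W'].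
    apply/eqP; rewrite eqn_leq ij -subn_eq0 /=; apply: contraT.
    have := congr1 (fun z => z - i%:R) e; rewrite subrr -natrB // => /esym/eqP.
    by case: (j - i)%N => // l; rewrite (negbTE (char0 l)).
  by rewrite size_map size_iota ltnn.
pose v' (i : 'I_n.+1) := if unlift ord_max i is Some j then v j else x.
exists v'; rewrite /meval -mmap_muni /= {2}/v' unlift_none.
have -> : map_poly (mmap idfun (fun i => v' (widen_ord (leqnSn n) i))) (muni p) = q.
  apply/polyP => i; rewrite !coef_map; apply: eq_mmap => // j.
  rewrite /v' (_ : widen_ord _ j = lift ord_max j) ?liftK //.
  by apply: val_inj; rewrite /= /bump leqNgt ltn_ord.
exact: qx.
Qed.

Lemma exists_ultra (T : Type) (B : (T -> Prop) -> Prop) :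
  (exists P, B P) -> (forall P Q, B P -> B Q -> exists2 R, B R & forall t, R t -> P t /\ Q t) ->
  (forall P, B P -> exists t, P t) ->
  exists U, ultra U /\ forall P, B P -> U P.
Proof.
move=> [P0 BP0] BI Bex.
pose F : (T -> Prop) -> Prop := fun P => exists2 Q, B Q & forall t, Q t -> P t.
have FF : filter.ProperFilter F.
  split; first by case=> Q /Bex [t Qt] H; exact: H Qt.
  split; first by exists P0.
  - move=> P Q [P' BP PP] [Q' BQ QQ]; have [R BR RR] := BI _ _ BP BQ.
    by exists R => // t /RR [/PP ? /QQ].
  - by move=> P Q PQ [P' BP PP]; exists P' => // t /PP/PQ.
have [U [UU FU]] := filter.ultraFilterLemma FF.
have [[U0 [UT UI US]] _] := UU.
exists U; split; last by move=> P BP; apply: FU; exists P.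
split.
- exact: UT.
- by move=> P Q PQ; apply: US.
- exact: UI.
- exact: U0.
- by move=> P; exact: (@filter.in_ultra_setVsetC _ U P UU).
Qed.

(** W is an ultrapower of C indexed by polynomials P, each standing for a point
    where it does not vanish if P <> 0. The ultrafilter contains the set of the
    nonzero multiples of any given Q <> 0: so Q is nonzero at almost all points,
    and evaluation at the points embeds the polynomial ring in W. *)
Theorem closed_extension (C : fieldType) n :
  (forall m, m.+1%:R != 0 :> C) -> (forall p : {poly C}, (1 < size p)%N -> exists x, root p x) ->
  exists (W : fieldType) (h : {rmorphism ratfun C n -> W}),
    forall p : {poly W}, (1 < size p)%N -> exists x, root p x.
Proof.
move=> char0 rootC.
have Hv (P : {mpoly C[n]}) : exists v : 'I_n -> C, P != 0 -> P.@[v] != 0.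
  have [->|P0] := eqVneq P 0; first by exists (fun=> 0).
  by have [v hv] := mpoly_nonzero_point char0 P0; exists v.
have [v hv] := choice Hv.
pose B (S : {mpoly C[n]} -> Prop) := exists2 Q, Q != 0 & S = (fun P => P != 0 /\ exists R, P = Q * R).
have [|||U [HU BU]] := @exists_ultra {mpoly C[n]} B.
- by eexists; exists 1; first exact: oner_neq0.
- move=> _ _ [Q Q0 ->] [Q' Q'0 ->]; eexists; first by exists (Q * Q'); first exact: mulf_neq0.
  by move=> P [P0 [R eP]]; split; split=> //; [exists (Q' * R) | exists (Q * R)]; rewrite eP; ring.
- by move=> _ [Q Q0 ->]; exists Q; split=> //; exists 1; rewrite mulr1.
pose W : fieldType := ultrapower C HU.
pose f (P : {mpoly C[n]}) : W := ultra_class HU (fun t => P.@[v t]).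
have [||| phi hphi] := @rmorphism_of {mpoly C[n]} W f.
- move=> P Q; rewrite /f ultra_classB; apply: ultra_class_eq; case: (HU) => UT US _ _ _.
  by apply: US UT => t _; rewrite mevalB.
- move=> P Q; rewrite /f ultra_classM; apply: ultra_class_eq; case: (HU) => UT US _ _ _.
  by apply: US UT => t _; rewrite mevalM.
- by apply: ultra_class_eq; case: (HU) => UT US _ _ _; apply: US UT => t _; rewrite meval1.
have phi_inj : injective phi.
  move=> P Q e; apply/eqP; rewrite -subr_eq0; apply: contraT => PQ.
  have : phi (P - Q) = 0 by rewrite rmorphB e subrr.
  rewrite hphi => /eqP/ultra_classP H; case: (HU) => UT US UI UF _; case: UF.
  have := BU _ (ex_intro2 _ _ (P - Q) PQ erefl).
  move=> /(UI _ _ H); apply: US => t [et [t0 [R tR]]].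
  have := congr1 (meval (v t)) tR; rewrite mevalM et mul0r => e0.
  by have := hv t t0; rewrite e0 eqxx.
have [psi _] := fraction_extend phi_inj.
by exists W, psi; exact: ultrapower_root.
Qed.

(** * Adjoining an element that depends on few parameters *)

Lemma additive_of (U V : zmodType) (f : U -> V) : (forall x y, f (x - y) = f x - f y) ->
  exists g : {additive U -> V}, forall x, g x = f x.
Proof.
move=> fB; pose add := GRing.isZmodMorphism.Build U V f fB.
by pose g : {additive U -> V} := HB.pack f add; exists g.
Qed.

Lemma simple_extension (F L : fieldType) (iota : {rmorphism F -> L}) (z : L) :
  algebraicOver iota z ->
  exists (Ft : fieldExtType F) (v : {rmorphism Ft -> L}) (x : Ft),
    [/\ v x = z, forall b, v b%:A = iota b
      & forall y, exists q : {poly F}, y = (map_poly (in_alg Ft) q).[x]].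
Proof.
case=> p0 p00 p0z.
have [p [pz np min_p]] : exists p : {poly F}, [/\ root (map_poly iota p) z, p != 0
    & forall q, root (map_poly iota q) z -> q != 0 -> (size p <= size q)%N].
  have [m] := ubnP (size p0); elim: m p0 p00 p0z => // m IH p p0 pz pm.
  have [H|] := pselect (forall q, root (map_poly iota q) z -> q != 0 -> (size p <= size q)%N).
    by exists p.
  move=> nH; have [q [qz q0 qp]] : exists q, [/\ root (map_poly iota q) z, q != 0
      & (size q < size p)%N].
    apply: contrapT => nex; apply: nH => q qz q0; rewrite leqNgt; apply/negP => qp.
    by apply: nex; exists q.
  by apply: (IH q) => //; apply: leq_trans qp _.
have irr_p := (subfx_irreducibleP pz np).1 min_p.
exists (SubFieldExtType pz irr_p), (subfx_inj (iota := iota) (z := z) (p := p)), (subfx_root iota z p).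
split.
- exact: subfx_inj_root.
- by move=> b; exact: subfx_inj_base.
- by move=> y; have [q ->] := subfxEroot pz np y; exists q.
Qed.

Lemma closed_splits (W : fieldType) : (forall p : {poly W}, (1 < size p)%N -> exists x, root p x) ->
  forall p : {poly W}, p \is monic -> exists rs : seq W, p = \prod_(r <- rs) ('X - r%:P).
Proof.
move=> rootW p; have [m] := ubnP (size p); elim: m p => // m IH p pm mp.
have [p1|p1] := leqP (size p) 1.
  exists [::]; rewrite big_nil; move: mp; rewrite (size1_polyC p1).
  by rewrite monicE lead_coefC => /eqP ->.
have [x /factor_theorem [q eq]] := rootW p p1.
have mq : q \is monic by move: mp; rewrite eq monicMr // monicXsubC.
have [|rs ers] := IH q _ mq.
  by rewrite eq size_Mmonic ?monic_neq0 ?monicXsubC // size_XsubC addn2 in pm.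
by exists (x :: rs); rewrite big_cons eq ers mulrC.
Qed.

Lemma field_closed_coef_prod (W : fieldType) (S : W -> Prop) (rs : seq W) k :
  field_closed S -> (forall r, r \in rs -> S r) -> S (\prod_(r <- rs) ('X - r%:P))`_k.
Proof.
move=> hS; elim: rs k => [|r rs IH] k Srs.
  by rewrite big_nil coef1; case: eqP => _; [exact: field_closed1 | exact: field_closed0].
have Sr : S r by apply: Srs; rewrite mem_head.
have {}IH j : S (\prod_(r0 <- rs) ('X - r0%:P))`_j by apply: IH => x xs; apply: Srs; rewrite inE xs orbT.
rewrite big_cons mulrBl coefB coefXM coefCM; apply: field_closedB => //.
  by case: eqP => _ //; exact: field_closed0.
exact: field_closedM.
Qed.

Lemma rmorphism_to_subvs (K F : fieldType) (M : fieldExtType K) (U : {subfield M})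
    (f : {rmorphism F -> M}) : (forall x, f x \in U) ->
  exists g : {rmorphism F -> subvs_of U}, forall x, vsval (g x) = f x.
Proof.
move=> fU; have [|||g e] := @rmorphism_of F (subvs_of U) (fun x => vsproj U (f x)).
- by move=> x y; apply: subvs_inj; rewrite (raddfB vsval) /= !(vsprojK (fU _)) rmorphB.
- by move=> x y; apply: subvs_inj; rewrite (rmorphM vsval) /= !(vsprojK (fU _)) rmorphM.
- by apply: subvs_inj; rewrite (rmorph1 vsval) /= (vsprojK (fU _)) rmorph1.
by exists g => x; rewrite e vsprojK.
Qed.

Section RDStep.
Variables (C K : fieldType) (iota : {rmorphism C -> K}) (W : fieldType).
Variables (cW : {rmorphism C -> W}) (M : fieldExtType K) (h : {rmorphism M -> W}).
Hypothesis hc : forall z, h (iota z)%:A = cW z.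
Hypothesis rootW : forall p : {poly W}, (1 < size p)%N -> exists x, root p x.

Let cM : {rmorphism C -> M} := in_alg M \o iota.
Let hcM z : h (cM z) = cW z. Proof. exact: hc. Qed.

(** In W the roots of g are roots of P, hence algebraic over t, and the
    coefficients of g are polynomials in its roots. *)
Lemma algebraic_over_monic_dvd m (t : 'I_m -> M) (g P : {poly M}) :
  g \is monic -> P != 0 -> g %| P -> (forall k, algebraic_over cM t P`_k) ->
  forall k, algebraic_over cM t g`_k.
Proof.
move=> mg P0 gP hP k; apply/(algebraic_over_morph hcM); rewrite -coef_map.
have [rs ers] := closed_splits rootW (monic_map h mg).
rewrite ers; apply: field_closed_coef_prod; first exact: algebraic_over_closed.
move=> r rrs; apply: (@algebraic_over_root _ _ _ _ _ (map_poly h P)).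
- by rewrite map_poly_eq0.
- have /dvdpP [q ->] : map_poly h g %| map_poly h P by rewrite dvdp_map.
  by rewrite rootM ers root_prod_XsubC rrs orbT.
- by move=> l; rewrite coef_map; apply/(algebraic_over_morph hcM).
Qed.

Variables (E : {subfield M}) (a : M) (d : nat) (t : 'I_d -> M).
Hypothesis tE : forall i, t i \in E.
Hypothesis alg_a : algebraic_over cM t a.

(* The field F of the tensor product: it has transcendence degree at most d,
   being algebraic over C(t). *)
Let S (x : M) : Prop := x \in E /\ algebraic_over cM t x.

Let S_closed : field_closed S.
Proof.
have hA := algebraic_over_closed cM t.
split; first by split; [exact: rpred1 | exact: field_closed1 hA].
- by move=> x y [xE xa] [yE ya]; split; [exact: rpredB | exact: field_closedB hA _ _ xa ya].
- by move=> x y [xE xa] [yE ya]; split; [exact: rpred_div | exact: field_closed_div hA _ _ xa ya].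
Qed.

Let S_cM z : S (cM z).
Proof.
split; first by rewrite /= rpredZ ?rpred1.
by apply: algebraic_over_adjoin; exact: in_adjoin_const.
Qed.

Let S_t i : S (t i).
Proof. by split=> //; apply: algebraic_over_adjoin; exact: in_adjoin_var. Qed.

Let F : fieldType := subfield_of S_closed.

Let minPoly_S k : S (minPoly E a)`_k.
Proof.
have pE := minPolyOver E a; split; first by move/polyOverP: pE; apply.
case: (alg_a) => P [P0 Pt Pa]; apply: (@algebraic_over_monic_dvd _ t _ P) => //.
- exact: monic_minPoly.
- apply: minPoly_dvdp => //; apply/polyOverP => l.
  apply: (@in_adjoin_min _ _ cM _ t (fun x => x \in E)) (Pt l) => //.
    by split; [exact: rpred1 | move=> x y; exact: rpredB | move=> x y; exact: rpred_div].
  by move=> z; case: (S_cM z).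
- by move=> l; apply: algebraic_over_adjoin.
Qed.

(** The minimal polynomial of a over E has its coefficients in F. Hence it is
    also the minimal polynomial G over F, and the powers of a of exponent less
    than its degree form a basis of E(a) over E and of F(a) over F at once: a
    balanced map is extended by its values on E times these powers. *)
Lemma RD_step_adjoin : RD_step iota d E <<E; a>>%AS.
Proof.
have [c hcF] : exists c : {rmorphism C -> F}, forall z, val (c z) = cM z.
  have [|||c e] := @rmorphism_of C F (fun z => in_subfield S_closed (S_cM z)).
  - by move=> x y; apply: val_inj; exact: (rmorphB cM).
  - by move=> x y; apply: val_inj; exact: (rmorphM cM).
  - by apply: val_inj; exact: (rmorph1 cM).
  by exists c => z; rewrite e.
have FE (x : F) : val x \in E by case: (sfvalP x).
have [j hj] := rmorphism_to_subvs (f := (val : {rmorphism F -> M})) FE.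
pose T := subvs_of <<E; a>>%AS.
have subET x : x \in E -> x \in <<E; a>>%AS by apply/subvP/subv_adjoin.
have [i hi] := rmorphism_to_subvs (f := (val : {rmorphism F -> M})) (fun x => subET _ (FE x)).
have [G hG] := field_closed_poly S_closed minPoly_S.
have G0 : G != 0.
  by rewrite -(map_poly_eq0 (val : {rmorphism F -> M})) hG monic_neq0 ?monic_minPoly.
have aT : a \in <<E; a>>%AS by exact: memv_adjoin.
have mapi (p : {poly F}) (x : T) : vsval (map_poly i p).[x] = (map_poly val p).[vsval x].
  rewrite -horner_map -map_poly_comp; congr (_.[_]).
  by apply: eq_map_poly => y; exact: hi.
have algT : algebraicOver i (vsproj <<E; a>>%AS a).
  exists G => //; apply/eqP/val_inj; by rewrite [LHS]mapi vsprojK // hG minPolyxx.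
have [Ft [v [x [vx vA Fx]]]] := simple_extension algT.
exists F, c, j, Ft, v; split.
- move=> z; apply: subvs_inj; rewrite [LHS]hj. transitivity (cM z); first exact: hcF.
  by rewrite [RHS]linearZ /= algid1.
- apply: (@trdeg_le_of_algebraic _ _ c d (fun l => in_subfield S_closed (S_t l))) => y.
  have hcM' z : (val : {rmorphism F -> M}) (c z) = cM z by exact: hcF.
  by apply/(algebraic_over_morph hcM'); case: (sfvalP y).
pose u (y : subvs_of E) : T := vsproj <<E; a>>%AS (vsval y).
have uE y : vsval (u y) = vsval y by rewrite vsprojK // subET // subvsP.
have vE (q : {poly F}) : vsval (v (map_poly (in_alg Ft) q).[x]) = (map_poly val q).[a].
  rewrite -horner_map /= -map_poly_comp vx.
  rewrite (eq_map_poly (g := i)) ?mapi ?vsprojK //; exact: vA.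
have small y : exists2 q : {poly F}, (size q < size G)%N & y = (map_poly (in_alg Ft) q).[x].
  have [q ->] := Fx y; exists (q %% G); first exact: ltn_modpN0.
  apply: (fmorph_inj v); apply: subvs_inj; rewrite !vE.
  rewrite {1}(divp_eq q G) rmorphD rmorphM /= hornerD hornerM hG minPolyxx mulr0 add0r.
  by [].
have sG : size G = (adjoin_degree E a).+1.
  by rewrite -size_minPoly -hG size_map_poly.
suff : is_tensor_product j (in_alg Ft) u v by [].
split.
  split.
  - by move=> y y' b; rewrite -mulrDl; congr (_ * _); apply: subvs_inj; rewrite (raddfD vsval) /= !uE.
  - by move=> y b b'; rewrite rmorphD mulrDr.
  - move=> z y b; rewrite rmorphM mulrA; congr (_ * _); apply: subvs_inj.
    by rewrite (rmorphM vsval) /= !uE vA hi (rmorphM vsval) /= hj.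
move=> V beta [betaDl betaDr betaM].
have beta0l b : beta 0 b = 0.
  by apply: (addrI (beta 0 b)); rewrite -betaDl !addr0.
have beta0r y : beta y 0 = 0.
  by apply: (addrI (beta y 0)); rewrite -betaDr !addr0.
have betaNl y b : beta (- y) b = - beta y b.
  by apply: (addrI (beta y b)); rewrite -betaDl !subrr beta0l.
pose n := adjoin_degree E a.
(* the coordinates of y on the powers of a *)
pose co (y : T) k : subvs_of E := vsproj E (Fadjoin_poly E a (vsval y))`_k.
have coE y k : vsval (co y k) = (Fadjoin_poly E a (vsval y))`_k.
  by rewrite vsprojK //; have /polyOverP := Fadjoin_polyOver E a (vsval y); apply.
have co_eq (p : {poly M}) y : p \is a polyOver E -> (size p <= n)%N -> p.[a] = vsval y ->
    forall k, vsval (co y k) = p`_k.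
  by move=> pE sp py k; rewrite coE (Fadjoin_poly_unique pE sp py).
have sumT y : y = \sum_(k < n) u (co y k) * v (x ^+ k).
  apply: subvs_inj; rewrite -{1}(Fadjoin_poly_eq (subvsP y)).
  rewrite (horner_coef_wide _ (size_Fadjoin_poly _ _ _)) raddf_sum /=.
  apply: eq_bigr => k _; rewrite uE coE rmorphXn vx; by rewrite (rmorphXn vsval) /= vsprojK.
have [|H hH] := @additive_of T V (fun y => \sum_(k < n) beta (co y k) (x ^+ k)).
  move=> y y'; rewrite -sumrB; apply: eq_bigr => k _; rewrite -betaNl -betaDl; congr beta.
  apply: subvs_inj; rewrite (raddfB vsval) /= !coE -coefB.
  rewrite (@Fadjoin_poly_unique _ _ E a (Fadjoin_poly E a (vsval y) - Fadjoin_poly E a (vsval y'))) //.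
  - by rewrite rpredB ?Fadjoin_polyOver.
  - by rewrite (leq_trans (size_polyD _ _)) // geq_max size_polyN !size_Fadjoin_poly.
  - by rewrite hornerD hornerN !Fadjoin_poly_eq ?subvsP.
exists H; split=> [y b|H' hH'].
  rewrite hH; have [q sq eb] := small b.
  have sqn : (size (map_poly val q : {poly M}) <= n)%N by rewrite size_map_poly -ltnS -sG.
  have cok k : co (u y * v b) k = y * j q`_k.
    apply: subvs_inj; rewrite (rmorphM vsval) /= hj.
    rewrite (co_eq (vsval y *: map_poly val q)) ?coefZ ?coef_map //.
    - apply/polyOverP => l; rewrite coefZ coef_map; apply: rpredM; first exact: subvsP.
      exact: FE.
    - by rewrite (leq_trans (size_scale_leq _ _)).
    - by rewrite hornerZ (rmorphM vsval) /= uE eb vE.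
  under eq_bigr do rewrite cok betaM.
  rewrite -(big_morph (beta y) (betaDr y) (beta0r y)); congr beta.
  rewrite eb (@horner_coef_wide _ n); last by rewrite size_map_poly -ltnS -sG.
  by apply: eq_bigr => k _; rewrite coef_map.
move=> y; rewrite hH {1}(sumT y) raddf_sum; apply: eq_bigr => k _; exact: hH'.
Qed.
End RDStep.

(** * The closure under adjunctions with d parameters *)

Section Towers.
Variables (C K : fieldType) (iota : {rmorphism C -> K}) (W : fieldType).
Variables (h0 : {rmorphism K -> W}) (d : nat).
Hypothesis rootW : forall p : {poly W}, (1 < size p)%N -> exists x, root p x.

Let cW : {rmorphism C -> W} := h0 \o iota.

(** Membership in the subfield of W generated by the image of K and s. *)
Definition generated (s : seq W) (y : W) : Prop :=
  forall S : W -> Prop, field_closed S -> (forall k, S (h0 k)) ->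
    (forall x, x \in s -> S x) -> S y.

(** The list is read from right to left: each entry is algebraic over at most d
    elements of the field generated by the entries after it. *)
Fixpoint tower (s : seq W) : Prop :=
  if s is x :: s' then
    tower s' /\ exists b : 'I_d -> W, (forall i, generated s' (b i)) /\ algebraic_over cW b x
  else True.

Lemma generated_sub s s' y : {subset s <= s'} -> generated s y -> generated s' y.
Proof. by move=> ss' H S hS S0 Ss'; apply: H => // x /ss'; exact: Ss'. Qed.

Lemma tower_cat s s' : tower s -> tower s' -> tower (s ++ s').
Proof.
elim: s => //= x s IH [ts [b [hb xb]]] ts'; split; first exact: IH.
exists b; split=> // i; apply: generated_sub (hb i) => y ys; by rewrite mem_cat ys.
Qed.

(** An inductive predicate, so that every element comes with the finitely many
    adjunctions that produce it. *)
Inductive rd_closure : W -> Prop :=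
| RdBase k : rd_closure (h0 k)
| RdSub x y : rd_closure x -> rd_closure y -> rd_closure (x - y)
| RdDiv x y : rd_closure x -> rd_closure y -> rd_closure (x / y)
| RdAlg (b : 'I_d -> W) x : (forall i, rd_closure (b i)) -> algebraic_over cW b x ->
    rd_closure x.

Lemma rd_closure_closed : field_closed rd_closure.
Proof.
split; [by rewrite -(rmorph1 h0); exact: RdBase | exact: RdSub | exact: RdDiv].
Qed.

Lemma rd_closure_tower x : rd_closure x -> exists s, tower s /\ generated s x.
Proof.
elim=> [k|y z _ [s [ts gs]] _ [s' [ts' gs']]|y z _ [s [ts gs]] _ [s' [ts' gs']]|b y _ IH yb].
- by exists [::]; split=> // S.
- exists (s ++ s'); split; first exact: tower_cat.
  move=> S hS S0 Ss; apply: field_closedB => //.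
    by apply: gs => // u us; apply: Ss; rewrite mem_cat us.
  by apply: gs' => // u us; apply: Ss; rewrite mem_cat us orbT.
- exists (s ++ s'); split; first exact: tower_cat.
  move=> S hS S0 Ss; apply: field_closed_div => //.
    by apply: gs => // u us; apply: Ss; rewrite mem_cat us.
  by apply: gs' => // u us; apply: Ss; rewrite mem_cat us orbT.
have [s hs] := choice IH.
exists (y :: flatten [seq s i | i <- enum 'I_d]); split; last first.
  by move=> S hS S0 Ss; apply: Ss; rewrite mem_head.
split.
  elim: (enum 'I_d) => //= i e IHe; apply: tower_cat => //; by case: (hs i).
exists b; split=> // i; case: (hs i) => _; apply: generated_sub => u us.
by apply/flattenP; exists (s i) => //; apply: map_f; rewrite mem_enum.
Qed.

Lemma resolvent_closed_closure : exists c : {rmorphism C -> subfield_of rd_closure_closed},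
  (forall z, val (c z) = h0 (iota z)) /\ resolvent_closed c d.
Proof.
have [|||c ec] := @rmorphism_of C (subfield_of rd_closure_closed)
    (fun z => in_subfield rd_closure_closed (RdBase (iota z))).
- by move=> x y; apply: val_inj; exact: (rmorphB cW).
- by move=> x y; apply: val_inj; exact: (rmorphM cW).
- by apply: val_inj; exact: (rmorph1 cW).
have hc z : (val : {rmorphism subfield_of rd_closure_closed -> W}) (c z) = cW z by rewrite ec.
exists c; split=> // b p sp pb.
have [|x rx] := rootW (p := map_poly val p); first by rewrite size_map_poly.
have xc : rd_closure x.
  apply: (@RdAlg (fun i => val (b i))); first by move=> i; exact: sfvalP.
  exists (map_poly val p); split=> //.
    by rewrite map_poly_eq0 -size_poly_gt0 ltnW.
  by move=> k; rewrite coef_map; apply/(in_adjoin_morph hc); exists p`_k.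
exists (in_subfield rd_closure_closed xc).
by rewrite -(fmorph_root (val : {rmorphism subfield_of rd_closure_closed -> W})).
Qed.

Lemma tower_algebraic s : tower s -> forall x, x \in s -> algebraicOver h0 x.
Proof.
have hA : field_closed (algebraicOver h0).
  split; [exact: algebraic1 | exact: algebraic_sub | exact: algebraic_div].
elim: s => //= x s IH [ts [b [hb [P [P0 Pb Px]]]]] y; rewrite inE => /orP [/eqP ->|ys]; last exact: IH.
have bA i : algebraicOver h0 (b i).
  apply: hb => //; last exact: IH.
  by move=> k; exact: algebraic_id.
apply/integral_algebraic; apply: (integral_root P0 Px) => _ /(nthP 0) [k _ <-].
apply/integral_algebraic; apply: (in_adjoin_min hA _ bA (Pb k)) => z; exact: algebraic_id.
Qed.

(** The entries are adjoined one at a time, by their minimal polynomials. *)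
Lemma realize s : (forall x, x \in s -> algebraicOver h0 x) ->
  exists (M : fieldExtType K) (h : {rmorphism M -> W}) (a : seq M),
    (forall k, h k%:A = h0 k) /\ map h a = s.
Proof.
elim: s => [|x s IH] hs.
  have [|M [h [y [_ hA _]]]] := @simple_extension K W h0 0; first exact: algebraic0.
  by exists M, h, [::].
have [|M [h [a [hA ha]]]] := IH; first by move=> y ys; apply: hs; rewrite inE ys orbT.
have algx : algebraicOver h x.
  have [p p0 px] := hs x (mem_head _ _).
  exists (map_poly (in_alg M) p); first by rewrite map_poly_eq0.
  by rewrite -map_poly_comp (eq_map_poly (g := h0)).
have [N [v [y [vy vA _]]]] := simple_extension algx.
exists (baseFieldType N), (v : {rmorphism N -> W}), (y :: map (in_alg N) a); split.
  move=> k; rewrite -hA -vA; congr (v _).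
by rewrite /= vy -map_comp; congr (_ :: _); rewrite -ha; apply: eq_map => z /=; exact: vA.
Qed.

(** Passing from M to its subfield generated by a is repeated until the dimension
    no longer drops. *)
Lemma realize_full s : (forall x, x \in s -> algebraicOver h0 x) ->
  exists (M : fieldExtType K) (h : {rmorphism M -> W}) (a : seq M),
    [/\ forall k, h k%:A = h0 k, map h a = s & <<1 & a>>%AS = fullv%AS].
Proof.
move=> /realize [M [h [a [hA ha]]]].
have [m] := ubnP (\dim {:M}); elim: m M h a hA ha => // m IH M h a hA ha dM.
have [full|nfull] := eqVneq (<<1 & a>>%AS) (fullv%AS : {subfield M}).
  by exists M, h, a.
pose U := <<1 & a>>%AS : {subfield M}.
apply: (IH (subvs_of U) (h \o vsval) (map (vsproj U) a)).
- by move=> k; rewrite /= algid1 hA.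
- rewrite -map_comp -ha; apply/eq_in_map => x xa /=; rewrite vsprojK //.
  exact: seqv_sub_adjoin.
- have dU : \dim {: subvs_of U} = \dim U by rewrite dimvf.
  rewrite dU -ltnS; apply: leq_trans dM; rewrite ltnS ltnNge; apply/negP => le.
  by case/eqP: nfull; apply/val_inj/eqP; rewrite eqEdim subvf.
Qed.

End Towers.

(** * From towers of elements to towers of fields *)

Section TowerToSubfields.
Variables (C K : fieldType) (iota : {rmorphism C -> K}) (W : fieldType).
Variables (h0 : {rmorphism K -> W}) (d : nat).
Hypothesis rootW : forall p : {poly W}, (1 < size p)%N -> exists x, root p x.
Variables (M : fieldExtType K) (h : {rmorphism M -> W}).
Hypothesis hA : forall k, h k%:A = h0 k.

Lemma generated_image a y : generated h0 (map h a) y -> exists2 m, m \in <<1 & a>>%VS & y = h m.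
Proof.
move=> H; apply: (H (fun y => exists2 m, m \in <<1 & a>>%VS & y = h m)).
- split; first by exists 1; rewrite ?rmorph1 ?rpred1.
    by move=> _ _ [x xa ->] [z za ->]; exists (x - z); rewrite ?rmorphB ?rpredB.
  by move=> _ _ [x xa ->] [z za ->]; exists (x / z); rewrite ?fmorph_div ?rpred_div.
- by move=> k; exists k%:A; rewrite ?hA // rpredZ ?rpred1.
- by move=> _ /mapP [x xa ->]; exists x => //; exact: seqv_sub_adjoin.
Qed.

Lemma adjoin_seq_cons (x : M) a : <<1 & x :: a>>%AS = <<<<1 & a>>; x>>%AS.
Proof.
apply: val_inj => /=; rewrite -adjoin_rcons; apply: subv_anti.
by rewrite !adjoin_seqSr // => y; rewrite mem_rcons.
Qed.

Lemma tower_RD_step x a : tower iota h0 d (map h (x :: a)) ->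
  RD_step iota d <<1 & a>>%AS <<1 & x :: a>>%AS.
Proof.
move=> /= [_ [b [hb xb]]]; rewrite adjoin_seq_cons.
have /choice [t ht] i : exists m, m \in <<1 & a>>%VS /\ b i = h m.
  by have [m ma e] := generated_image (hb i); exists m.
have hc z : h (iota z)%:A = (h0 \o iota) z by exact: hA.
apply: (RD_step_adjoin hc rootW (t := t)) => [i|]; first by case: (ht i).
apply/(algebraic_over_morph (h := h) (c' := h0 \o iota)); first by move=> z; exact: hc.
by have -> : h \o t = b by apply: funext => i /=; case: (ht i).
Qed.

Lemma tower_drop k s : tower iota h0 d s -> tower iota h0 d (drop k s).
Proof. by elim: s k => [|x s IH] [|k] //= [ts _]; exact: IH. Qed.

(** The i-th field is generated by the last i entries of a. *)
Lemma tower_RD_le (L : fieldExtType K) a : tower iota h0 d (map h a) ->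
  <<1 & a>>%AS = fullv%AS -> (exists f : {lrmorphism L -> M}, injective f) ->
  RD_le iota L d.
Proof.
move=> ta fa fL; exists M, (size a), (fun i => <<1 & drop (size a - i) a>>%AS); split=> //.
- by rewrite subn0 drop_size; apply: val_inj; rewrite /= Fadjoin_nil.
- by rewrite subnn drop0.
move=> i ia; have lt : (size a - i.+1 < size a)%N by rewrite ltn_subrL (leq_ltn_trans _ ia).
rewrite (drop_nth 0 lt) subnSK //; set x := a`_ _; set a' := drop _ a; split.
  by apply: adjoin_seqSr => y; rewrite inE => ->; rewrite orbT.
apply: tower_RD_step; rewrite /x /a' -(subnSK ia) -(drop_nth 0 lt) map_drop.
exact: tower_drop.
Qed.
End TowerToSubfields.

(** * The bounds for the resolvent degree *)

Lemma qfpoly_embedding (K : fieldType) (p : {poly K}) (irr : monic_irreducible_poly p)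
    (M : fieldExtType K) (x : M) : root (map_poly (in_alg M) p) x ->
  exists f : {lrmorphism ({poly %/ p with irr} : fieldExtType K) -> M}, injective f.
Proof.
move=> px; pose ev (q : {poly K}) : M := (map_poly (in_alg M) q).[x].
have evD q r : ev (q + r) = ev q + ev r by rewrite /ev rmorphD hornerD.
have evB q r : ev (q - r) = ev q - ev r by rewrite /ev rmorphB hornerD hornerN.
have evM q r : ev (q * r) = ev q * ev r by rewrite /ev rmorphM hornerM.
have ev1 : ev 1 = 1 by rewrite /ev rmorph1 hornerC.
have evZ k q : ev (k *: q) = k *: ev q.
  by rewrite /ev map_polyZ hornerZ mulr_algl.
pose L : fieldExtType K := {poly %/ p with irr}.
pose f (q : L) : M := ev (q : {poly %/ p}).
have fB : {morph f : q r / q - r} by move=> q r; exact: evB.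
have f1 : f 1 = 1.
  by rewrite /f -[RHS]ev1; have -> : ((1 : {poly %/ p}) : {poly K}) = 1 by [].
have fM : {morph f : q r / q * r}.
  move=> q r; rewrite /f -evM.
  rewrite [X in ev X](poly_of_qpolyM (q : {poly %/ p}) (r : {poly %/ p})).
  set u := _ * _; rewrite (mk_monicE irr) -(Pdiv.IdomainMonic.modpE irr.2).
  rewrite {2}(divp_eq u p) evD evM.
  by rewrite {3}/ev (rootP px) mulr0 add0r.
have fZ : scalable f by move=> k q; exact: evZ.
pose add := GRing.isZmodMorphism.Build L M f fB.
pose mul := GRing.isMonoidMorphism.Build L M f (conj f1 fM).
pose sc := GRing.isScalable.Build K L M *:%R f fZ.
pose g : {lrmorphism L -> M} := HB.pack f add mul sc.
exists g; exact: (fmorph_inj g).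
Qed.

Section GeneralRD.
Variable C : fieldType.
Hypothesis char0 : forall m, m.+1%:R != 0 :> C.
Hypothesis rootC : forall p : {poly C}, (1 < size p)%N -> exists x, root p x.

(** The general polynomial has a root in the closure of its field of coefficients
    under adjunctions with d parameters; the finitely many adjunctions that
    produce this root make up the tower. *)
Lemma degree_solvable_RD_le l n (n0 : (0 < n)%N) d : degree_solvable C l n -> (n - l <= d)%N ->
  RD_le (ratfunC C n) (general_ext C n0) d.
Proof.
move=> sol nld; have [W [h0 rootW]] := closed_extension n char0 rootC.
have [c [hc cl]] := resolvent_closed_closure (ratfunC C n) h0 d rootW.
set E := subfield_of _ in c hc cl.
have [|||b hb] := @rmorphism_of (ratfun C n) E
    (fun z => in_subfield (rd_closure_closed (ratfunC C n) h0 d) (RdBase _ h0 d z)).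
- by move=> x y; apply: val_inj; exact: (rmorphB h0).
- by move=> x y; apply: val_inj; exact: (rmorphM h0).
- by apply: val_inj; exact: (rmorph1 h0).
have charE m : m.+1%:R != 0 :> E by rewrite -(rmorph_nat c) fmorph_eq0.
have [|z rz] := sol E c d (map_poly b (general_poly C n)) charE cl nld.
  by rewrite size_map_poly size_general_poly.
have [s [ts gz]] := rd_closure_tower (sfvalP z).
have [M [h [a [hA ha fa]]]] := realize_full (tower_algebraic ts).
have [|x _ ex] := generated_image hA (a := a) (y := val z); first by rewrite ha.
apply: (tower_RD_le rootW hA (a := a)) => //; first by rewrite ha.
apply: (@qfpoly_embedding _ _ _ _ x).
rewrite -(fmorph_root h) -map_poly_comp -ex.
move: rz; rewrite -(fmorph_root (val : {rmorphism E -> W})) -map_poly_comp.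
congr root; apply: eq_map_poly => k /=.
by rewrite hb hA.
Qed.

(** RD(n) is the least d for which a tower exists. *)
Lemma general_RD_le l n : (0 < n)%N -> degree_solvable C l n ->
  exists2 r, is_general_RD C n r & (r <= n - l)%N.
Proof.
move=> n0 sol; have RDle := degree_solvable_RD_le n0 sol (leqnn _).
have ex : exists r, `[< RD_le (ratfunC C n) (general_ext C n0) r >].
  by exists (n - l)%N; apply/asboolP.
case: (ex_minnP ex) => r /asboolP RDr min_r; exists r.
  by exists n0; split=> // e /asboolP; exact: min_r.
by apply: min_r; apply/asboolP.
Qed.

End GeneralRD.

(* The ground field is R[i]; "RD(n) <= k" is stated for the value r of RD(n). *)
Theorem theorem3p10 (R : realType) :
  [/\ forall n : nat, (109 <= n)%N ->
        exists2 r : nat, is_general_RD R[i] n r & (r <= n - 7)%N,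
      forall n : nat, (325 <= n)%N ->
        exists2 r : nat, is_general_RD R[i] n r & (r <= n - 8)%N
    & forall l n : nat, (9 <= l <= 14)%N -> ((l.-1)`! < 24 * n)%N ->
        exists2 r : nat, is_general_RD R[i] n r & (r <= n - l)%N].
Proof.
have char0 m : m.+1%:R != 0 :> R[i] by rewrite Num.Theory.pnatr_eq0.
have rootC (p : {poly R[i]}) : (1 < size p)%N -> exists x, root p x.
  by move=> sp; apply/closed_rootP; rewrite gtn_eqF.
split=> [n n109|n n325|l n hl hn].
- by apply: (general_RD_le char0 rootC); [lia | exact: degree_solvable7].
- by apply: (general_RD_le char0 rootC); [lia | exact: degree_solvable8].
- by apply: (general_RD_le char0 rootC); [lia | exact: degree_solvable_9_14].
Qed.
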